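(* For $i\in\{0,1,\dots,6\}$ let $G_i\subset\mathrm{PSL}(2,\mathbb{C})$ be the two-generator group specified in the context. Then the invariant trace field of $G_i$ is the subfield $\mathbb{Q}(\tau_i)$ of $\mathbb{C}$, where $\tau_i$ is the root, nearest to the given numerical value, of the given minimal polynomial: $i=0$: $\tau^2+3$, $\tau_0\approx 1.732050808i$; $i=1$: $\tau^4-2\tau^3+\tau^2-2\tau+1$, $\tau_1\approx -0.207106781+0.978318343i$; $i=2$: $\tau^2+1$, $\tau_2=i$ (the imaginary unit); $i=3$: $\tau^{12}+6\tau^{11}+23\tau^{10}+91\tau^9+257\tau^8+489\tau^7+823\tau^6+1054\tau^5-13\tau^4-2445\tau^3-3405\tau^2-1847\tau-337$, $\tau_3\approx 0.632778000-3.019170376i$; $i=4$: $\tau^3-\tau-2$, $\tau_4\approx -0.760689853+0.857873626i$; $i=5$: $\tau^3-\tau^2+\tau+1$, $\tau_5\approx 0.771844506+1.11514250i$; $i=6$: $\tau^3-\tau^2+\tau+1$, $\tau_6\approx 0.771844506-1.11514250i$.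
   Context: The trace field of a subgroup $G\subset\mathrm{PSL}(2,\mathbb{C})$ is the field $\mathbb{Q}(\mathrm{tr}\,G)$ generated by traces of elements of the preimage of $G$ in $\mathrm{SL}(2,\mathbb{C})$. The invariant trace field $k(G)$ is the intersection of the fields $\mathbb{Q}(\mathrm{tr}\,H)$ over all finite index subgroups $H$ of $G$; equivalently (Reid) $k(G)=\mathbb{Q}(\{\mathrm{tr}^2(g):g\in G\})=\mathbb{Q}(\mathrm{tr}\,G^{(2)})$, where $G^{(2)}$ is generated by the squares of elements of $G$. The group $G_i$ is the subgroup of $\mathrm{PSL}(2,\mathbb{C})$ generated by $$f=\begin{pmatrix}0&1\\-1&\mathrm{tr}_1\end{pmatrix},\qquad w=\begin{pmatrix}z&0\\ \mathrm{tr}_1 z-\mathrm{tr}_3&\mathrm{tr}_2-z\end{pmatrix},$$ where $z(\mathrm{tr}_2-z)=1$, $\mathrm{tr}_1=\mathrm{tr}(f)$, $\mathrm{tr}_2=\mathrm{tr}(w)=\mathrm{tr}_1$, $\mathrm{tr}_3=\mathrm{tr}(f^{-1}w)$, and $z=z_i$ is the root, nearest to the given numerical value, of the given polynomial: $i=0$: $\tau^8+2\tau^6+6\tau^4+2\tau^2+1$, $z\approx 0.853230697-1.252448658i$; $\mathrm{tr}_1=-z-6z^3-2z^5-z^7$, $\mathrm{tr}_3=(-5z^2-2z^4-z^6)/2$. $i=1$: $\tau^8-2\tau^7+5\tau^6-4\tau^5+7\tau^4-4\tau^3+5\tau^2-2\tau+1$, $z\approx 0.904047196-1.471654224i$; $\mathrm{tr}_1=\mathrm{tr}_3=2-4z+4z^2-7z^3+4z^4-5z^5+2z^6-z^7$.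 $i=2$: $\tau^4-2\tau^3+4\tau^2-2\tau+1$, $z\approx 0.742934136-1.529085514i$; $\mathrm{tr}_1=\mathrm{tr}_3=2-3z+2z^2-z^3$. $i=3$: $\tau^{24}-8\tau^{23}+35\tau^{22}-107\tau^{21}+261\tau^{20}-538\tau^{19}+972\tau^{18}-1565\tau^{17}+2282\tau^{16}-3034\tau^{15}+3706\tau^{14}-4171\tau^{13}+4339\tau^{12}-4171\tau^{11}+3706\tau^{10}-3034\tau^9+2282\tau^8-1565\tau^7+972\tau^6-538\tau^5+261\tau^4-107\tau^3+35\tau^2-8\tau+1$, $z\approx 1.404292212-1.179267298i$; $\mathrm{tr}_1=\mathrm{tr}_3=8-34z+107z^2-261z^3+538z^4-972z^5+1565z^6-2282z^7+3034z^8-3706z^9+4171z^{10}-4339z^{11}+4171z^{12}-3706z^{13}+3034z^{14}-2282z^{15}+1565z^{16}-972z^{17}+538z^{18}-261z^{19}+107z^{20}-35z^{21}+8z^{22}-z^{23}$. $i=4$: $\tau^6-3\tau^5+5\tau^4-4\tau^3+5\tau^2-3\tau+1$, $z\approx 1.354619901-1.225125454i$; $\mathrm{tr}_1=\mathrm{tr}_3=3-4z+4z^2-5z^3+3z^4-z^5$. $i=5$: $\tau^{12}+2\tau^{10}+7\tau^8-4\tau^6+7\tau^4+2\tau^2+1$, $z\approx 0.868063287-1.460023666i$; $\mathrm{tr}_1=-z-7z^3+4z^5-7z^7-2z^9-z^{11}$, $\mathrm{tr}_3=(-6z^2+4z^4-7z^6-2z^8-z^{10})/2$. $i=6$: $\tau^{12}-2\tau^{10}+7\tau^8+4\tau^6+7\tau^4-2\tau^2+1$,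 $z\approx 1.460023666-0.868063287i$; $\mathrm{tr}_1=3z-7z^3-4z^5-7z^7+2z^9-z^{11}$, $\mathrm{tr}_3=(4-6z^2-4z^4-7z^6+2z^8-z^{10})/2$. *)

(* Defs.v *)
From HB Require Import structures.
From mathcomp Require Import all_boot all_order all_algebra.
From mathcomp Require Import ring.
From mathcomp Require Import boolp classical_sets cardinality reals complex.

Set Implicit Arguments.
Unset Strict Implicit.
Unset Printing Implicit Defensive.

Import Order.TTheory GRing.Theory Num.Theory.

Local Open Scope quotient_scope.
Local Open Scope classical_set_scope.
Local Open Scope ring_scope.

Section SL2.
Variable F : fieldType.

Record SL2 := MkSL2 { SL2val :> 'M[F]_2; SL2P : \det SL2val == 1 }.

HB.instance Definition _ := [isSub for SL2val].
HB.instance Definition _ := [Choice of SL2 by <:].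

Implicit Types A B C : SL2.

Fact SL2_one_subproof : \det (1%:M : 'M[F]_2) == 1.
Proof. by rewrite det1. Qed.

Definition SL2_one : SL2 := MkSL2 SL2_one_subproof.

Fact SL2_mul_subproof A B : \det (SL2val A *m SL2val B) == 1.
Proof. by rewrite det_mulmx (eqP (SL2P A)) (eqP (SL2P B)) mulr1. Qed.

Definition SL2_mul A B : SL2 := MkSL2 (SL2_mul_subproof A B).

Fact SL2_inv_subproof A : \det (invmx (SL2val A)) == 1.
Proof. by rewrite det_inv (eqP (SL2P A)) invr1. Qed.

Definition SL2_inv A : SL2 := MkSL2 (SL2_inv_subproof A).

Lemma SL2_unitmx A : SL2val A \in unitmx.
Proof. by rewrite unitmxE (eqP (SL2P A)) unitr1. Qed.

Fact SL2_mulA : associative SL2_mul.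
Proof. by move=> A B C; apply: val_inj; rewrite /= mulmxA. Qed.

Fact SL2_mul1 : left_id SL2_one SL2_mul.
Proof. by move=> A; apply: val_inj; rewrite /= mul1mx. Qed.

Fact SL2_mulr1 : right_id SL2_one SL2_mul.
Proof. by move=> A; apply: val_inj; rewrite /= mulmx1. Qed.

Fact SL2_mulV : left_inverse SL2_one SL2_inv SL2_mul.
Proof. by move=> A; apply: val_inj; rewrite /= mulVmx ?SL2_unitmx. Qed.

Fact SL2_mulrV : right_inverse SL2_one SL2_inv SL2_mul.
Proof. by move=> A; apply: val_inj; rewrite /= mulmxV ?SL2_unitmx. Qed.

HB.instance Definition _ :=
  isGroup.Build SL2 SL2_mulA SL2_mul1 SL2_mulr1 SL2_mulV SL2_mulrV.

Definition SL2_eqv A B : bool :=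
  (SL2val A == SL2val B) || (SL2val A == - SL2val B).

Fact SL2_eqv_refl : reflexive SL2_eqv.
Proof. by move=> A; rewrite /SL2_eqv eqxx. Qed.

Fact SL2_eqv_sym : symmetric SL2_eqv.
Proof.
by move=> A B; rewrite /SL2_eqv eq_sym -[in RHS]eqr_oppLR [- _ == _]eq_sym.
Qed.

Fact SL2_eqv_trans : transitive SL2_eqv.
Proof.
move=> B A C; rewrite /SL2_eqv => /orP[] /eqP -> /orP[] /eqP ->;
  by rewrite ?opprK eqxx ?orbT.
Qed.

Canonical SL2_eqv_equiv :=
  EquivRel SL2_eqv SL2_eqv_refl SL2_eqv_sym SL2_eqv_trans.

Definition PSL2 := {eq_quot SL2_eqv}.

HB.instance Definition _ := Choice.on PSL2.
HB.instance Definition _ := EqQuotient.on PSL2.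

Definition PSL2_one : PSL2 := \pi_PSL2 SL2_one.
Definition PSL2_mul (x y : PSL2) : PSL2 := \pi_PSL2 (SL2_mul (repr x) (repr y)).
Definition PSL2_inv (x : PSL2) : PSL2 := \pi_PSL2 (SL2_inv (repr x)).

Lemma PSL2_repr_pi A :
  SL2val (repr (\pi_PSL2 A)) = A \/ SL2val (repr (\pi_PSL2 A)) = - SL2val A.
Proof.
have /eqmodP : repr (\pi_PSL2 A) = A %[mod PSL2] by rewrite reprK.
by rewrite /= /SL2_eqv => /orP[] /eqP; [left | right].
Qed.

Lemma PSL2_mulE A B :
  PSL2_mul (\pi_PSL2 A) (\pi_PSL2 B) = \pi_PSL2 (SL2_mul A B).
Proof.
apply/eqmodP; rewrite /= /SL2_eqv /=.
by have [-> | ->] := PSL2_repr_pi A; have [-> | ->] := PSL2_repr_pi B;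
  rewrite ?mulNmx ?mulmxN ?opprK eqxx ?orbT.
Qed.

Lemma PSL2_invE A : PSL2_inv (\pi_PSL2 A) = \pi_PSL2 (SL2_inv A).
Proof.
apply/eqmodP; rewrite /= /SL2_eqv /=.
have [-> | ->] := PSL2_repr_pi A; first by rewrite eqxx.
rewrite -scaleN1r invmxZ ?unitmxZ ?unitrN1 ?SL2_unitmx //.
by rewrite invrN1 scaleN1r eqxx orbT.
Qed.

Fact PSL2_mulA : associative PSL2_mul.
Proof.
elim/quotP=> A _; elim/quotP=> B _; elim/quotP=> D _.
by rewrite (PSL2_mulE B D) (PSL2_mulE A B) PSL2_mulE (PSL2_mulE _ D) SL2_mulA.
Qed.

Fact PSL2_mul1 : left_id PSL2_one PSL2_mul.
Proof. by elim/quotP=> A _; rewrite /PSL2_one PSL2_mulE SL2_mul1. Qed.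

Fact PSL2_mulr1 : right_id PSL2_one PSL2_mul.
Proof. by elim/quotP=> A _; rewrite /PSL2_one PSL2_mulE SL2_mulr1. Qed.

Fact PSL2_mulV : left_inverse PSL2_one PSL2_inv PSL2_mul.
Proof. by elim/quotP=> A _; rewrite PSL2_invE PSL2_mulE SL2_mulV. Qed.

Fact PSL2_mulrV : right_inverse PSL2_one PSL2_inv PSL2_mul.
Proof. by elim/quotP=> A _; rewrite PSL2_invE PSL2_mulE SL2_mulrV. Qed.

HB.instance Definition _ :=
  isGroup.Build PSL2 PSL2_mulA PSL2_mul1 PSL2_mulr1 PSL2_mulV PSL2_mulrV.

End SL2.

Definition is_subgroup (T : groupType) (H : set T) : Prop :=
  group_closed (mem H).

Definition is_subfield (F : fieldType) (K : set F) : Prop :=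
  GRing.divring_closed (mem K).

Definition generated_subgroup (T : groupType) (X : set T) : set T :=
  smallest (@is_subgroup T) X.

(* Q(S): in characteristic 0 every subfield contains Q, so the smallest
   subfield containing S is Q(S). *)
Definition Qadjoin (F : numFieldType) (S : set F) : set F :=
  smallest (@is_subfield F) S.

Definition finite_index (T : groupType) (G H : set T) : Prop :=
  finite_set [set [set (g * h)%g | h in H] | g in G].

Definition trace_field (F : numFieldType) (G : set (PSL2 F)) : set F :=
  Qadjoin [set \tr (SL2val A) | A in [set A : SL2 F | G (\pi_(PSL2 F) A)]].

Definition invariant_trace_field (F : numFieldType) (G : set (PSL2 F)) : set F :=
  \bigcap_(H in [set H : set (PSL2 F) |
                  [/\ is_subgroup H, H `<=` G & finite_index G H]])
    trace_field H.

Definition Qroot (F : numFieldType) (p : {poly rat}) (x : F) : Prop :=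
  root (map_poly ratr p) x.

Definition Qeval (F : numFieldType) (x : F) (p : {poly rat}) : F :=
  (map_poly ratr p).[x].

Lemma Qeval_rules (F : numFieldType) (x : F) :
  [/\ forall p q, Qeval x (p + q) = Qeval x p + Qeval x q,
      forall p, Qeval x (- p) = - Qeval x p,
      forall n q, Qeval x (n%:R * q) = n%:R * Qeval x q,
      forall n, Qeval x 'X^n = x ^+ n &
      Qeval x 'X = x /\ forall n, Qeval x n%:R = n%:R].
Proof.
have En n : Qeval x n%:R = n%:R by rewrite /Qeval rmorph_nat -polyC_natr hornerC.
split=> [p q|p|n q|n|].
- by rewrite /Qeval rmorphD hornerD.
- by rewrite /Qeval rmorphN hornerN.
- by rewrite -[in RHS]En /Qeval rmorphM hornerM.
- by rewrite /Qeval map_polyXn hornerXn.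
by split=> //; rewrite /Qeval map_polyX hornerX.
Qed.

Definition is_nearest_root (F : numFieldType) (p : {poly rat}) (a x : F) : Prop :=
  Qroot p x /\ forall y : F, Qroot p y -> `|x - a| <= `|y - a|.

Definition is_minimal_polynomial (F : numFieldType) (p : {poly rat}) (x : F)
    : Prop :=
  [/\ p \is monic, Qroot p x &
      forall q : {poly rat}, q != 0 -> Qroot q x -> (size p <= size q)%N].

(* The decimal u.abc with a, b, c blocks of three digits; unary literals with
   nine digits would be intractable. *)
Definition dec (R : realType) (u a b c : nat) : R :=
  u%:R + a%:R / 10 ^+ 3 + b%:R / 10 ^+ 6 + c%:R / 10 ^+ 9.

Section Data.
Variable R : realType.
Local Notation C := R[i].
Local Open Scope complex_scope.

Record group_data := GroupData {
  z_poly : {poly rat};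
  z_approx : C;
  tr1 : C -> C;
  tr3 : C -> C;
  tau_poly : {poly rat};
  tau_approx : C }.

Definition data0 := {|
  z_poly := 'X^8 + 2 * 'X^6 + 6 * 'X^4 + 2 * 'X^2 + 1;
  z_approx := dec R 0 853 230 697 -i* dec R 1 252 448 658;
  tr1 z := - z - 6 * z ^+ 3 - 2 * z ^+ 5 - z ^+ 7;
  tr3 z := (- (5 * z ^+ 2) - 2 * z ^+ 4 - z ^+ 6) / 2;
  tau_poly := 'X^2 + 3;
  tau_approx := 0 +i* dec R 1 732 050 808 |}.

Definition tr_data1 (z : C) : C :=
  2 - 4 * z + 4 * z ^+ 2 - 7 * z ^+ 3 + 4 * z ^+ 4 - 5 * z ^+ 5 + 2 * z ^+ 6
  - z ^+ 7.

Definition data1 := {|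
  z_poly := 'X^8 - 2 * 'X^7 + 5 * 'X^6 - 4 * 'X^5 + 7 * 'X^4 - 4 * 'X^3
            + 5 * 'X^2 - 2 * 'X + 1;
  z_approx := dec R 0 904 047 196 -i* dec R 1 471 654 224;
  tr1 := tr_data1;
  tr3 := tr_data1;
  tau_poly := 'X^4 - 2 * 'X^3 + 'X^2 - 2 * 'X + 1;
  tau_approx := (- dec R 0 207 106 781) +i* dec R 0 978 318 343 |}.

Definition tr_data2 (z : C) : C := 2 - 3 * z + 2 * z ^+ 2 - z ^+ 3.

Definition data2 := {|
  z_poly := 'X^4 - 2 * 'X^3 + 4 * 'X^2 - 2 * 'X + 1;
  z_approx := dec R 0 742 934 136 -i* dec R 1 529 085 514;
  tr1 := tr_data2;
  tr3 := tr_data2;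
  tau_poly := 'X^2 + 1;
  tau_approx := 0 +i* 1 |}.

Definition tr_data3 (z : C) : C :=
  8 - 34 * z + 107 * z ^+ 2 - 261 * z ^+ 3 + 538 * z ^+ 4 - 972 * z ^+ 5
  + 1565 * z ^+ 6 - 2282 * z ^+ 7 + 3034 * z ^+ 8 - 3706 * z ^+ 9
  + 4171 * z ^+ 10 - 4339 * z ^+ 11 + 4171 * z ^+ 12 - 3706 * z ^+ 13
  + 3034 * z ^+ 14 - 2282 * z ^+ 15 + 1565 * z ^+ 16 - 972 * z ^+ 17
  + 538 * z ^+ 18 - 261 * z ^+ 19 + 107 * z ^+ 20 - 35 * z ^+ 21
  + 8 * z ^+ 22 - z ^+ 23.

Definition data3 := {|
  z_poly := 'X^24 - 8 * 'X^23 + 35 * 'X^22 - 107 * 'X^21 + 261 * 'X^20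
            - 538 * 'X^19 + 972 * 'X^18 - 1565 * 'X^17 + 2282 * 'X^16
            - 3034 * 'X^15 + 3706 * 'X^14 - 4171 * 'X^13 + 4339 * 'X^12
            - 4171 * 'X^11 + 3706 * 'X^10 - 3034 * 'X^9 + 2282 * 'X^8
            - 1565 * 'X^7 + 972 * 'X^6 - 538 * 'X^5 + 261 * 'X^4
            - 107 * 'X^3 + 35 * 'X^2 - 8 * 'X + 1;
  z_approx := dec R 1 404 292 212 -i* dec R 1 179 267 298;
  tr1 := tr_data3;
  tr3 := tr_data3;
  tau_poly := 'X^12 + 6 * 'X^11 + 23 * 'X^10 + 91 * 'X^9 + 257 * 'X^8
              + 489 * 'X^7 + 823 * 'X^6 + 1054 * 'X^5 - 13 * 'X^4
              - 2445 * 'X^3 - 3405 * 'X^2 - 1847 * 'X - 337;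
  tau_approx := dec R 0 632 778 000 -i* dec R 3 019 170 376 |}.

Definition tr_data4 (z : C) : C :=
  3 - 4 * z + 4 * z ^+ 2 - 5 * z ^+ 3 + 3 * z ^+ 4 - z ^+ 5.

Definition data4 := {|
  z_poly := 'X^6 - 3 * 'X^5 + 5 * 'X^4 - 4 * 'X^3 + 5 * 'X^2 - 3 * 'X + 1;
  z_approx := dec R 1 354 619 901 -i* dec R 1 225 125 454;
  tr1 := tr_data4;
  tr3 := tr_data4;
  tau_poly := 'X^3 - 'X - 2;
  tau_approx := (- dec R 0 760 689 853) +i* dec R 0 857 873 626 |}.

Definition data5 := {|
  z_poly := 'X^12 + 2 * 'X^10 + 7 * 'X^8 - 4 * 'X^6 + 7 * 'X^4 + 2 * 'X^2 + 1;
  z_approx := dec R 0 868 063 287 -i* dec R 1 460 023 666;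
  tr1 z := - z - 7 * z ^+ 3 + 4 * z ^+ 5 - 7 * z ^+ 7 - 2 * z ^+ 9 - z ^+ 11;
  tr3 z := (- (6 * z ^+ 2) + 4 * z ^+ 4 - 7 * z ^+ 6 - 2 * z ^+ 8
            - z ^+ 10) / 2;
  tau_poly := 'X^3 - 'X^2 + 'X + 1;
  tau_approx := dec R 0 771 844 506 +i* dec R 1 115 142 500 |}.

Definition data6 := {|
  z_poly := 'X^12 - 2 * 'X^10 + 7 * 'X^8 + 4 * 'X^6 + 7 * 'X^4 - 2 * 'X^2 + 1;
  z_approx := dec R 1 460 023 666 -i* dec R 0 868 063 287;
  tr1 z := 3 * z - 7 * z ^+ 3 - 4 * z ^+ 5 - 7 * z ^+ 7 + 2 * z ^+ 9 - z ^+ 11;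
  tr3 z := (4 - 6 * z ^+ 2 - 4 * z ^+ 4 - 7 * z ^+ 6 + 2 * z ^+ 8
            - z ^+ 10) / 2;
  tau_poly := 'X^3 - 'X^2 + 'X + 1;
  tau_approx := dec R 0 771 844 506 -i* dec R 1 115 142 500 |}.

Definition data (i : 'I_7) : group_data :=
  nth data0 [:: data0; data1; data2; data3; data4; data5; data6] i.

Definition mx2 (a b c d : C) : 'M[C]_2 :=
  \matrix_(i < 2, j < 2)
    if i == 0 then (if j == 0 then a else b) else (if j == 0 then c else d).

Lemma det_mx2 a b c d : \det (mx2 a b c d) = a * d - b * c.
Proof.
rewrite (expand_det_row _ 0) !big_ord_recl big_ord0 /cofactor !det_mx11 !mxE /=.
ring.
Qed.

Definition f_mx (t1 : C) : 'M[C]_2 := mx2 0 1 (-1) t1.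

Definition w_mx (t1 t2 t3 z : C) : 'M[C]_2 := mx2 z 0 (t1 * z - t3) (t2 - z).

Lemma f_mxP t1 : \det (f_mx t1) == 1.
Proof. by rewrite det_mx2 mul0r mul1r opprK add0r. Qed.

(* The relation z (tr2 - z) = 1, with tr2 = tr1. *)
Lemma z_rel i z : Qroot (z_poly (data i)) z -> z * (tr1 (data i) z - z) = 1.
Proof.
rewrite /Qroot => /rootP; rewrite -/(Qeval z _).
have [] := Qeval_rules z; move: (Qeval z) => ev evD evN evM evXn [evX evn].
have ev1 : ev 1 = 1 := evn 1%N.
case: i => -[|[|[|[|[|[|[|//]]]]]]] ltn7;
  rewrite /data /= ?(evD, evN, evM, evXn, evX, ev1, evn) => h;
  rewrite -[RHS]subr0 -h ?/tr_data1 ?/tr_data2 ?/tr_data3 ?/tr_data4; ring.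
Qed.

Lemma w_mxP i z : Qroot (z_poly (data i)) z ->
  \det (w_mx (tr1 (data i) z) (tr1 (data i) z) (tr3 (data i) z) z) == 1.
Proof. by move=> hz; rewrite det_mx2 mul0r subr0 z_rel. Qed.

Definition fSL i z : SL2 C := MkSL2 (f_mxP (tr1 (data i) z)).
Definition wSL i z (hz : Qroot (z_poly (data i)) z) : SL2 C := MkSL2 (w_mxP hz).

Definition Ggroup i z (hz : Qroot (z_poly (data i)) z) : set (PSL2 C) :=
  generated_subgroup [set \pi_(PSL2 C) (fSL i z); \pi_(PSL2 C) (wSL hz)].

End Data.

(* Main.v *)
(** Write [t = tr f = tr w = z + 1/z] and [s = tr (f^-1 w)].  The invariant trace
    field of [G = <f, w>] is [Q(t^2, s)].  Indeed [t f] and [t w] span, together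
    with [1] and their product, a quaternion algebra [A] over [K = Q(t^2, s)];
    each element of [G] has a lift in [A] or in [t^-1 A], so the elements lifting
    to [A] form a subgroup of index at most 2, with traces in [K].  Conversely a
    subgroup [H] of finite index contains [f^n], [w^n] and [f w^n f^-1] for some
    [n > 0]; since [f^n = p f + q] and [w^n = p w + q] with [p <> 0] (because [z]
    is not a root of unity), [t^2] and [s] are rational functions of the traces
    of [f^n], [f^n w^n] and [f w^n f^-1 w^n].

    In each of the seven cases [s] is [t] or [t^2 / 2], and [tau] is a polynomial
    of degree at most 2 in [t]: its value is a root of the given polynomial, and
    it is the nearest one to the given decimal by a Taylor expansion with
    Gaussian integer coefficients.  The polynomial of [tau] is irreducible
    modulo a small prime. *)

From HB Require Import structures.
From Stdlib Require Import ZArith.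
From mathcomp Require Import all_boot all_order all_algebra.
From mathcomp Require Import ring zify ssrZ.
From mathcomp Require Import boolp classical_sets cardinality reals complex.
Require Import Defs.

Set Implicit Arguments.
Unset Strict Implicit.
Unset Printing Implicit Defensive.

Import Order.TTheory GRing.Theory Num.Theory.
Local Open Scope quotient_scope.
Local Open Scope classical_set_scope.
Local Open Scope ring_scope.

(** * Subfields and subgroups *)

Section Subfield.
Variable F : numFieldType.
Implicit Types (K S : set F) (x y : F).

Lemma Qadjoin_is_subfield S : is_subfield (Qadjoin S).
Proof.
split=> [|x y|x y]; rewrite !inE.
- by move=> K [[K1 _ _] _]; rewrite inE in K1.
- move=> Sx Sy K HK; have := Sx K HK; have := Sy K HK.
  by case: HK => -[_ h _] _ Ky Kx; have := h x y; rewrite !inE; apply.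
- move=> Sx Sy K HK; have := Sx K HK; have := Sy K HK.
  by case: HK => -[_ _ h] _ Ky Kx; have := h x y; rewrite !inE; apply.
Qed.

Lemma Qadjoin_mem S x : S x -> Qadjoin S x.
Proof. by move=> Sx; apply: sub_gen_smallest. Qed.

Lemma Qadjoin_sub S K : is_subfield K -> S `<=` K -> Qadjoin S `<=` K.
Proof. exact: smallest_sub. Qed.

Variable K : set F.
Hypothesis subK : is_subfield K.

Lemma subfield1 : K 1. Proof. by case: subK => h _ _; rewrite inE in h. Qed.

Lemma subfieldB x y : K x -> K y -> K (x - y).
Proof. by case: subK => _ h _; have := h x y; rewrite !inE; apply. Qed.

Lemma subfield_div x y : K x -> K y -> K (x / y).
Proof. by case: subK => _ _ h; have := h x y; rewrite !inE; apply. Qed.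

Lemma subfield0 : K 0.
Proof. by rewrite -(subrr 1); apply: subfieldB; apply: subfield1. Qed.

Lemma subfieldN x : K x -> K (- x).
Proof. by rewrite -sub0r; apply: subfieldB; apply: subfield0. Qed.

Lemma subfieldD x y : K x -> K y -> K (x + y).
Proof.
by move=> Kx Ky; rewrite -[y]opprK; apply: subfieldB => //; apply: subfieldN.
Qed.

Lemma subfieldV x : K x -> K x^-1.
Proof. by rewrite -div1r; apply: subfield_div; apply: subfield1. Qed.

Lemma subfieldM x y : K x -> K y -> K (x * y).
Proof.
by move=> Kx Ky; rewrite -[y]invrK; apply: subfield_div => //; apply: subfieldV.
Qed.

Lemma subfield_nat n : K n%:R.
Proof.
elim: n => [|n IHn]; first exact: subfield0.
by rewrite -addn1 natrD; apply: subfieldD => //; apply: subfield1.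
Qed.

Lemma subfield_int (m : int) : K m%:~R.
Proof.
case: m => n; first exact: subfield_nat.
by rewrite NegzE rmorphN; apply/subfieldN/subfield_nat.
Qed.

Lemma subfieldX x n : K x -> K (x ^+ n).
Proof.
move=> Kx; elim: n => [|n IHn]; first by rewrite expr0; apply: subfield1.
by rewrite exprS; apply: subfieldM.
Qed.

End Subfield.

Ltac subfield_closure :=
  repeat first [ assumption | apply: subfield0 | apply: subfield1
    | apply: subfield_nat | apply: subfield_int | apply: subfieldB | apply: subfieldN
    | apply: subfieldD | apply: subfieldM | apply: subfieldV
    | apply: subfieldX ].

Section Subgroup.
Variable T : groupType.
Implicit Types (G H X : set T) (g x y : T).

Lemma is_subgroup_generated X : is_subgroup (generated_subgroup X).
Proof.
split=> [|x y]; rewrite !inE; first by move=> H [[H1 _] _]; rewrite inE in H1.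
move=> Xx Xy H HH; have := Xx H HH; have := Xy H HH.
by case: HH => -[_ h] _ Hy Hx; have := h x y; rewrite !inE; apply.
Qed.

Section Closure.
Variable H : set T.
Hypothesis subH : is_subgroup H.

Lemma subgroup1 : H 1%g.
Proof. by case: subH => h _; rewrite inE in h. Qed.

Lemma subgroup_div x y : H x -> H y -> H (x / y)%g.
Proof. by case: subH => _ h; have := h x y; rewrite !inE; apply. Qed.

Lemma subgroupV x : H x -> H (x^-1)%g.
Proof. by rewrite -div1g; apply: subgroup_div; apply: subgroup1. Qed.

Lemma subgroupM x y : H x -> H y -> H (x * y)%g.
Proof.
by move=> Hx Hy; rewrite -[y]invgK; apply: subgroup_div => //; apply: subgroupV.
Qed.

Lemma subgroupX x n : H x -> H (x ^+ n)%g.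
Proof.
move=> Hx; elim: n => [|n IHn]; first by rewrite expg0; apply: subgroup1.
by rewrite expgS; apply: subgroupM.
Qed.

Lemma eq_coset x y : H (x^-1 * y)%g ->
  [set (x * h)%g | h in H] = [set (y * h)%g | h in H].
Proof.
move=> Hxy; rewrite eqEsubset; split=> _ [h Hh <-].
  exists ((x^-1 * y)^-1 * h)%g; first by apply: subgroupM => //; apply: subgroupV.
  by rewrite invgM invgK !mulgA mulgV mul1g.
by exists (x^-1 * y * h)%g; [apply: subgroupM | rewrite !mulgA mulgV mul1g].
Qed.

Lemma coset_eqP x y :
  [set (x * h)%g | h in H] = [set (y * h)%g | h in H] -> H (x^-1 * y)%g.
Proof.
move=> xHyH; have : [set (y * h)%g | h in H] y.
  by exists 1%g; [exact: subgroup1 | rewrite mulg1].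
by rewrite -xHyH => -[h Hh <-]; rewrite mulgA mulVg mul1g.
Qed.

End Closure.

(** Pigeonhole: there are finitely many cosets [g ^+ n H], so two of them with different exponents
    coincide, and the difference of the exponents is the required [n]. *)
Lemma finite_index_expg G H g : is_subgroup G -> is_subgroup H ->
  finite_index G H -> G g -> exists2 n, (0 < n)%N & H (g ^+ n)%g.
Proof.
move=> subG subH finGH Gg.
pose c (n : nat) := [set (g ^+ n * h)%g | h in H].
apply: contrapT => none; apply: infinite_nat.
(* If no positive power lies in [H], then [c] is injective, and the preimage of a finite set under
   it would be all of [nat]. *)
suff -> : [set: nat] = c @^-1` [set [set (x * h)%g | h in H] | x in G].
  apply: finite_preimage => // i j _ _ cij.
  wlog: i j cij / (i <= j)%N => [W|].
    by case: (leqP i j) => [|/ltnW] /W => [|/(_ (esym cij))/esym]; apply.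
  rewrite leq_eqVlt => /orP[/eqP//|ltij]; case: none.
  exists (j - i)%N; rewrite ?subn_gt0 //; have := coset_eqP subH cij.
  by rewrite -{1}(subnKC (ltnW ltij)) expgnDr mulgA mulVg mul1g.
by rewrite eqEsubset; split=> // n _; exists (g ^+ n)%g => //; apply: subgroupX.
Qed.

End Subgroup.

(** * Traces in a two-generator subgroup of PSL(2, C) *)

Section Group.
Variable R : realType.
Local Notation C := R[i].
Implicit Types (z s t a b c d : C) (M N : 'M[C]_2).

Lemma mx2_eta M : M = mx2 (M 0 0) (M 0 1) (M 1 0) (M 1 1).
Proof.
by apply/matrixP=> i j; rewrite mxE; case: i => -[|[|//]] ?; case: j => -[|[|//]] ?;
  congr (M _ _); apply: val_inj.
Qed.

Lemma mx2M a b c d a' b' c' d' : mx2 a b c d *m mx2 a' b' c' d' =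
  mx2 (a * a' + b * c') (a * b' + b * d') (c * a' + d * c') (c * b' + d * d').
Proof.
apply/matrixP=> i j; rewrite !mxE !big_ord_recl big_ord0 !mxE /=.
by case: eqP => _; case: eqP => _; rewrite addr0.
Qed.

Lemma mx2D a b c d a' b' c' d' : mx2 a b c d + mx2 a' b' c' d' =
  mx2 (a + a') (b + b') (c + c') (d + d').
Proof.
by apply/matrixP=> i j; rewrite !mxE; case: eqP => _; case: eqP => _.
Qed.

Lemma mx2Z k a b c d : k *: mx2 a b c d = mx2 (k * a) (k * b) (k * c) (k * d).
Proof.
by apply/matrixP=> i j; rewrite !mxE; case: eqP => _; case: eqP => _.
Qed.

Lemma mx2_scalar a : a%:M = mx2 a 0 0 a.
Proof.
apply/matrixP=> i j; rewrite !mxE.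
by case: i => -[|[|//]] ?; case: j => -[|[|//]] ?; rewrite ?mulr1n ?mulr0n.
Qed.

Lemma tr_mx2 a b c d : \tr (mx2 a b c d) = a + d.
Proof. by rewrite /mxtrace !big_ord_recl big_ord0 !mxE /= addr0. Qed.

Lemma invmx2 a b c d : a * d - b * c = 1 ->
  invmx (mx2 a b c d) = mx2 d (- b) (- c) a.
Proof.
move=> ad1; have AB : mx2 a b c d *m mx2 d (- b) (- c) a = 1%:M.
  by rewrite mx2M mx2_scalar -ad1; congr mx2; ring.
have [Au _] := mulmx1_unit AB.
by rewrite -[RHS](mulKmx Au) AB mulmx1.
Qed.

(** * The quaternion algebra spanned by 1, t f, t w and their product *)

Section Quaternion.
Variables (z s : C).
Hypothesis z0 : z != 0.
Let t := z + z^-1.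
Variable K : set C.
Hypothesis subK : is_subfield K.
Hypotheses (Kt2 : K (t ^+ 2)) (Ks : K s).

Local Notation f := (f_mx t).
Local Notation w := (w_mx t t s z).

(** The factors [t] turn the traces and structure constants of the generators into polynomials in
    [t ^+ 2] and [s]. *)
Definition quat a b c d : 'M[C]_2 :=
  a%:M + b *: (t *: f) + c *: (t *: w) + d *: ((t *: f) *m (t *: w)).

Definition quat_alg : set 'M[C]_2 :=
  [set M | exists a b c d, [/\ K a, K b, K c & K d] /\ M = quat a b c d].

Lemma quatE a b c d : quat a b c d =
  mx2 (a + c * t * z + d * t ^+ 2 * (t * z - s))
      (b * t + d * t ^+ 2 * (t - z))
      (- b * t + c * t * (t * z - s) + d * t ^+ 2 * (- z + t * (t * z - s)))
      (a + b * t ^+ 2 + c * t * (t - z) + d * t ^+ 3 * (t - z)).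
Proof.
rewrite /quat /f_mx /w_mx mx2_scalar !mx2Z !mx2M !mx2Z !mx2D.
by congr mx2; ring.
Qed.

Lemma tr_quat a b c d :
  \tr (quat a b c d) = 2 * a + b * t ^+ 2 + c * t ^+ 2 + d * t ^+ 2 * (t ^+ 2 - s).
Proof. by rewrite quatE tr_mx2; ring. Qed.

Lemma quatD a b c d a' b' c' d' :
  quat a b c d + quat a' b' c' d' = quat (a + a') (b + b') (c + c') (d + d').
Proof. by rewrite !quatE mx2D; congr mx2; ring. Qed.

Lemma quatZ k a b c d :
  k *: quat a b c d = quat (k * a) (k * b) (k * c) (k * d).
Proof. by rewrite !quatE mx2Z; congr mx2; ring. Qed.

(** Cayley-Hamilton: X = t f satisfies X^2 = t^2 X - t^2. *)
Lemma mul_f_quat a b c d : (t *: f) *m quat a b c d =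
  quat (- (t ^+ 2 * b)) (a + t ^+ 2 * b) (- (t ^+ 2 * d)) (c + t ^+ 2 * d).
Proof.
by rewrite !quatE /f_mx mx2Z mx2M; congr mx2; rewrite /t; field.
Qed.

(** With X = t f and Y = t w, the coefficients come from Y^2 = t^2 Y - t^2 and Y X = - X Y + t^2 X +
    t^2 Y - t^2 s; the latter is the polarized Cayley-Hamilton identity, where tr (f w) = t^2 -
    s. *)
Lemma mul_w_quat a b c d : (t *: w) *m quat a b c d =
  quat (- (b * t ^+ 2 * s) - c * t ^+ 2 - d * t ^+ 4)
       (b * t ^+ 2 + d * t ^+ 2)
       (a + b * t ^+ 2 + c * t ^+ 2 + d * (t ^+ 4 - t ^+ 2 * s)) (- b).
Proof.
by rewrite !quatE /w_mx mx2Z mx2M; congr mx2; rewrite /t; field.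
Qed.

Lemma quat_algD M N : quat_alg M -> quat_alg N -> quat_alg (M + N).
Proof.
move=> [a [b [c [d [[Ka Kb Kc Kd] ->]]]]] [a' [b' [c' [d' [[Ka' Kb' Kc' Kd'] ->]]]]].
by rewrite quatD; do 4!eexists; split; last reflexivity; split; subfield_closure.
Qed.

Lemma quat_algZ k M : K k -> quat_alg M -> quat_alg (k *: M).
Proof.
move=> Kk [a [b [c [d [[Ka Kb Kc Kd] ->]]]]].
by rewrite quatZ; do 4!eexists; split; last reflexivity; split; subfield_closure.
Qed.

Lemma quat_alg_f M : quat_alg M -> quat_alg ((t *: f) *m M).
Proof.
move=> [a [b [c [d [[Ka Kb Kc Kd] ->]]]]].
by rewrite mul_f_quat; do 4!eexists; split; last reflexivity; split; subfield_closure.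
Qed.

Lemma quat_alg_w M : quat_alg M -> quat_alg ((t *: w) *m M).
Proof.
move=> [a [b [c [d [[Ka Kb Kc Kd] ->]]]]].
have Kt4 : K (t ^+ 4) by rewrite (exprM t 2 2); subfield_closure.
by rewrite mul_w_quat; do 4!eexists; split; last reflexivity; split; subfield_closure.
Qed.

(** By linearity in the left factor, only left multiplication by the basis elements matters. *)
Lemma quat_algM M N : quat_alg M -> quat_alg N -> quat_alg (M *m N).
Proof.
move=> [a [b [c [d [[Ka Kb Kc Kd] ->]]]]] AN.
have -> : quat a b c d *m N = a *: N + b *: ((t *: f) *m N) + c *: ((t *: w) *m N)
    + d *: ((t *: f) *m ((t *: w) *m N)).
  rewrite /quat; move: (t *: f) (t *: w) => X Y.
  by rewrite !mulmxDl mul_scalar_mx -!scalemxAl mulmxA.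
have Af := quat_alg_f AN; have Aw := quat_alg_w AN; have Afw := quat_alg_f Aw.
by apply: quat_algD; [apply: quat_algD; [apply: quat_algD|]|]; apply: quat_algZ.
Qed.

Lemma quat_alg_scalar a : K a -> quat_alg a%:M.
Proof.
move=> Ka; exists a, 0, 0, 0; split; first by split=> //; apply: subfield0.
by rewrite /quat !scale0r !addr0.
Qed.

Lemma quat_alg_tr M : quat_alg M -> K (\tr M).
Proof.
by move=> [a [b [c [d [[Ka Kb Kc Kd] ->]]]]]; rewrite tr_quat; subfield_closure.
Qed.

(** This is the adjugate of [M], hence its inverse when the determinant is 1; the algebra is thus
    stable under inverses taken in SL(2). *)
Lemma quat_alg_adj M : quat_alg M -> quat_alg ((\tr M)%:M - M).
Proof.
move=> AM; apply: quat_algD; first exact/quat_alg_scalar/quat_alg_tr.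
by rewrite -scaleN1r; apply: quat_algZ => //; subfield_closure.
Qed.

End Quaternion.

Lemma SL2V_val (A : SL2 C) : SL2val A^-1%g = (\tr (SL2val A))%:M - SL2val A.
Proof.
change (invmx (SL2val A) = (\tr (SL2val A))%:M - SL2val A).
move: (SL2val A) (eqP (SL2P A)) => M; rewrite (mx2_eta M) det_mx2 => detM.
rewrite [LHS]invmx2 // tr_mx2 mx2_scalar -(scaleN1r (mx2 _ _ _ _)) mx2Z mx2D.
by congr mx2; ring.
Qed.

Lemma pi_mul (A B : SL2 C) :
  (\pi_(PSL2 C) A * \pi_(PSL2 C) B)%g = \pi_(PSL2 C) (A * B)%g.
Proof. exact: PSL2_mulE. Qed.

Lemma pi_inv (A : SL2 C) : ((\pi_(PSL2 C) A)^-1)%g = \pi_(PSL2 C) (A^-1)%g.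
Proof. exact: PSL2_invE. Qed.

Lemma pi_exp (A : SL2 C) n : (\pi_(PSL2 C) A ^+ n)%g = \pi_(PSL2 C) (A ^+ n)%g.
Proof.
by elim: n => [|n IHn]; rewrite ?expg0 // !expgS IHn pi_mul.
Qed.

Lemma pi_eq (A B : SL2 C) : \pi_(PSL2 C) A = \pi_(PSL2 C) B ->
  SL2val A = SL2val B \/ SL2val A = - SL2val B.
Proof. by move/eqmodP; rewrite /= /SL2_eqv => /orP[] /eqP; [left | right]. Qed.

Lemma SL2M_val (A B : SL2 C) : SL2val (A * B)%g = SL2val A *m SL2val B.
Proof. by []. Qed.

Lemma SL2X_val (A : SL2 C) n : SL2val (A ^+ n)%g = SL2val A ^+ n.
Proof.
elim: n => [|n IHn]; first by rewrite expg0 expr0.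
by rewrite expgS exprS SL2M_val IHn.
Qed.

(** * Upper bound: a subgroup of index at most 2 with traces in K *)

Section UpperBound.
Variables (z s : C).
Hypothesis z0 : z != 0.
Let t := z + z^-1.
Hypothesis t0 : t != 0.
Variables A B : SL2 C.
Hypotheses (fE : SL2val A = f_mx t) (wE : SL2val B = w_mx t t s z).

Let G := generated_subgroup [set \pi_(PSL2 C) A; \pi_(PSL2 C) B].
Let subG : is_subgroup G := is_subgroup_generated _.
Variable K : set C.
Hypothesis subK : is_subfield K.
Hypotheses (Kt2 : K (t ^+ 2)) (Ks : K s).

Let Q := quat_alg z s K.

Let QM M N : Q M -> Q N -> Q (M *m N). Proof. exact: (quat_algM z0 subK Kt2 Ks). Qed.
Let QZ k M : K k -> Q M -> Q (k *: M). Proof. exact: (quat_algZ subK). Qed.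
Let QZV k M : k != 0 -> K k -> Q (k *: M) -> Q M.
Proof.
move=> k0 Kk QM'; rewrite -[M]scale1r -(mulVf k0) -scalerA.
by apply: QZ => //; apply: subfieldV.
Qed.
Let QN M : Q M -> Q (- M).
Proof. by move=> QM'; rewrite -scaleN1r; apply: QZ => //; subfield_closure. Qed.
Let QV (D : SL2 C) k : Q (k *: SL2val D) -> Q (k *: SL2val D^-1%g).
Proof.
move/(quat_alg_adj subK Kt2 Ks).
by rewrite SL2V_val scalerBr mxtraceZ -scale_scalar_mx.
Qed.
Let QV1 (D : SL2 C) : Q (SL2val D) -> Q (SL2val D^-1%g).
Proof. by have := @QV D 1; rewrite !scale1r. Qed.

Let t2_neq0 : t ^+ 2 != 0. Proof. by rewrite expf_neq0. Qed.

Let Q1 : Q 1%:M. Proof. by apply: (quat_alg_scalar _ _ subK); subfield_closure. Qed.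
Let Qtf : Q (t *: SL2val A).
Proof. by rewrite fE -[_ *: _]mulmx1; apply: (quat_alg_f z0 subK Kt2). Qed.
Let Qtw : Q (t *: SL2val B).
Proof. by rewrite wE -[_ *: _]mulmx1; apply: (quat_alg_w z0 subK Kt2 Ks). Qed.

(** The generators lift to t^-1 A, and the union of A and t^-1 A is stable under quotients of
    elements of determinant 1, as t^2 is a nonzero scalar of [K]. *)
Lemma lift_quat (g : PSL2 C) : G g ->
  exists2 D, g = \pi_(PSL2 C) D & Q (SL2val D) \/ Q (t *: SL2val D).
Proof.
pose S := [set g : PSL2 C |
  exists2 D, g = \pi_(PSL2 C) D & Q (SL2val D) \/ Q (t *: SL2val D)].
apply: (_ : G `<=` S); apply: smallest_sub; last first.
  by move=> _ [->|->]; [exists A | exists B]; auto.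
split=> [|x y]; rewrite !inE; first by exists 1%g; [|left].
move=> [D -> QD] [E -> QE]; exists (D * E^-1)%g; first by rewrite -pi_mul -pi_inv.
rewrite SL2M_val; case: QD QE => [QD|QD] [QE|QE].
- by left; apply: QM => //; apply: QV1.
- by right; rewrite scalemxAr; apply: QM => //; apply: QV.
- by right; rewrite scalemxAl; apply: QM => //; apply: QV1.
(* Two factors in t^-1 A: [t ^+ 2] times the product lies in A, and [t ^+ 2] is invertible in
   [K]. *)
left; apply: (@QZV (t ^+ 2)) => //.
by rewrite expr2 -scalerA scalemxAr scalemxAl; apply: QM => //; apply: QV.
Qed.

(* It has index at most 2: every element of [G] lies in [H0] or in [f H0]. *)
Let H0 := [set g : PSL2 C | G g /\ exists2 D, g = \pi_(PSL2 C) D & Q (SL2val D)].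

Lemma is_subgroup_quat : is_subgroup H0.
Proof.
split=> [|x y]; rewrite !inE.
  by split; [exact: (subgroup1 subG) | exists 1%g].
move=> [Gx [D xE QD]] [Gy [E yE QE]]; split; first exact: (subgroup_div subG).
exists (D * E^-1)%g; first by rewrite xE yE -pi_mul -pi_inv.
by rewrite SL2M_val; apply: QM => //; apply: QV1.
Qed.

Lemma finite_index_quat : finite_index G H0.
Proof.
have GA : G (\pi_(PSL2 C) A) by apply: sub_gen_smallest; left.
apply: (@sub_finite_set _ _ [set [set (x * h)%g | h in H0] |
  x in [set 1%g; \pi_(PSL2 C) A]]); last first.
  by apply: finite_image; apply: finite_set2.
move=> _ [g Gg <-]; have [D gE [QD|QD]] := lift_quat Gg.
  exists 1%g; first by left.
  apply: (eq_coset is_subgroup_quat).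
  by rewrite invg1 mul1g; split=> //; exists D.
exists (\pi_(PSL2 C) A); first by right.
apply: (eq_coset is_subgroup_quat).
split; first by apply: (subgroupM subG) => //; apply: (subgroupV subG).
exists (A^-1 * D)%g; first by rewrite gE -pi_mul -pi_inv.
(* Both [A^-1] and [D] lie in t^-1 A, so their product is in A after division by [t ^+ 2]. *)
rewrite SL2M_val; apply: (@QZV (t ^+ 2)) => //.
by rewrite expr2 -scalerA scalemxAr scalemxAl; apply: QM => //; apply: QV.
Qed.

Lemma invariant_trace_field_sub : invariant_trace_field G `<=` K.
Proof.
move=> x /(_ H0) TF; have {TF} : trace_field H0 x.
  apply: TF; split; [exact: is_subgroup_quat | by move=> ? [] |].
  exact: finite_index_quat.
move=> TF; apply: Qadjoin_sub TF => // _ [D [_ [E DE QE]] <-].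
apply: (quat_alg_tr subK Kt2 Ks); rewrite -/Q.
(* A matrix above an element of [H0] equals the lift [E] only up to sign, and the algebra is stable
   under sign. *)
by have [->|->] := pi_eq DE => //; apply: QN.
Qed.

End UpperBound.

(** * Lower bound: t^2 and s from the traces of a finite index subgroup *)

Section LowerBound.
Variables (z s : C).
Hypothesis z0 : z != 0.
Let t := z + z^-1.

(* The pair (p, q) with M^n = p M + q whenever M^2 = t M - 1. *)
Fixpoint power_coefs n : C * C :=
  if n is n'.+1 then let: (p, q) := power_coefs n' in (p * t + q, - p) else (0, 1).

Lemma power_coefs_mx n M : M *m M = t *: M - 1%:M ->
  M ^+ n = (power_coefs n).1 *: M + (power_coefs n).2%:M.
Proof.
move=> M2; elim: n => [|n] /=; first by rewrite scale0r add0r expr0.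
case: (power_coefs n) => p q /= IHn; rewrite exprS IHn -[_ * _]/(_ *m _).
rewrite mulmxDr -scalemxAr M2 mul_mx_scalar scalerBr scalerA scalerDl.
by rewrite scale_scalar_mx mulr1 addrAC raddfN.
Qed.

(** The scalars [z] and [z^-1] are the roots of X^2 - t X + 1, so the reduction of the n-th power
    holds for them too. *)
Lemma power_coefs_eigen n :
  (power_coefs n).1 * z + (power_coefs n).2 = z ^+ n /\
  (power_coefs n).1 / z + (power_coefs n).2 = z ^- n.
Proof.
elim: n => [|n] /=; first by rewrite expr0 invr1 !mul0r !add0r.
case: (power_coefs n) => p q /= [E1 E2]; rewrite !exprS invfM -E2 -E1 /t.
by split; field.
Qed.

Hypotheses (zX : forall n, (0 < n)%N -> z ^+ n != 1).
Hypotheses (s2 : s != 2) (ts2 : t ^+ 2 - s != 2).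
Variables A B : SL2 C.
Hypotheses (fE : SL2val A = f_mx t) (wE : SL2val B = w_mx t t s z).

Let G := generated_subgroup [set \pi_(PSL2 C) A; \pi_(PSL2 C) B].

(** If p = 0, both eigenvalue equations read q = z^n = z^-n, so that z^(2n) = 1. *)
Lemma power_coefs_neq0 n : (0 < n)%N -> (power_coefs n).1 != 0.
Proof.
move=> n_gt0; apply/eqP => p0.
have /eqP[] : z ^+ (n + n) != 1 by apply: zX; rewrite addn_gt0 n_gt0.
have [] := power_coefs_eigen n; rewrite p0 !mul0r !add0r exprD => -> zV.
by rewrite {1}zV mulVf // expf_neq0.
Qed.

(** The left side is the determinant of p M + q, the product of its eigenvalues z^n and z^-n. *)
Lemma power_coefs_det n :
  (power_coefs n).2 ^+ 2 + (power_coefs n).1 * (power_coefs n).2 * t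
  + (power_coefs n).1 ^+ 2 = 1.
Proof.
have [E1 E2] := power_coefs_eigen n.
move: (power_coefs n).1 (power_coefs n).2 E1 E2 => p q E1 E2.
transitivity ((p * z + q) * (p / z + q)); first by rewrite /t; field.
by rewrite E1 E2 mulfV ?expf_neq0.
Qed.

Lemma f_sqr : f_mx t *m f_mx t = t *: f_mx t - 1%:M.
Proof.
rewrite /f_mx mx2M mx2Z mx2_scalar -(scaleN1r (mx2 _ _ _ _)) mx2Z mx2D.
by congr mx2; ring.
Qed.

Lemma w_sqr : w_mx t t s z *m w_mx t t s z = t *: w_mx t t s z - 1%:M.
Proof.
rewrite /w_mx mx2M mx2Z mx2_scalar -(scaleN1r (mx2 _ _ _ _)) mx2Z mx2D /t.
by congr mx2; field.
Qed.

Lemma f_inv : SL2val A^-1%g = mx2 t (-1) 1 0.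
Proof.
rewrite SL2V_val fE /f_mx tr_mx2 mx2_scalar -(scaleN1r (mx2 _ _ _ _)) mx2Z mx2D.
by congr mx2; ring.
Qed.

Section Powers.
Variable n : nat.
Local Notation p := (power_coefs n).1.
Local Notation q := (power_coefs n).2.

Lemma tr_f_exp : \tr (SL2val (A ^+ n)%g) = p * t + 2 * q.
Proof.
rewrite SL2X_val fE power_coefs_mx ?f_sqr // mx2_scalar mx2Z mx2D tr_mx2; by ring.
Qed.

Lemma tr_fw_exp :
  \tr (SL2val (A ^+ n * B ^+ n)%g) = p ^+ 2 * (t ^+ 2 - s) + 2 * p * q * t + 2 * q ^+ 2.
Proof.
rewrite SL2M_val !SL2X_val fE wE !power_coefs_mx ?f_sqr ?w_sqr //.
rewrite mx2_scalar !mx2Z !mx2D mx2M tr_mx2 /t; by field.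
Qed.

(** The coefficient of p^2 is tr (f w f^-1 w) = tr (f w) tr (f^-1 w) - tr (f^2), with tr (f w) = t^2
    - s and tr (f^2) = t^2 - 2. *)
Lemma tr_conj_exp :
  \tr (SL2val (A * B ^+ n * A^-1 * B ^+ n)%g) =
  p ^+ 2 * (t ^+ 2 * (t ^+ 2 - s) - t ^+ 2 - (t ^+ 2 - s) ^+ 2 + 2)
  + 2 * p * q * t + 2 * q ^+ 2.
Proof.
rewrite !SL2M_val f_inv !SL2X_val fE wE !power_coefs_mx ?w_sqr //.
rewrite mx2_scalar !mx2Z !mx2D !mx2M tr_mx2 /t; by field.
Qed.

End Powers.

Lemma trace_field_ge H : is_subgroup H -> finite_index G H ->
  [set t ^+ 2; s] `<=` trace_field H.
Proof.
move=> subH finH.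
have GA : G (\pi_(PSL2 C) A) by apply: sub_gen_smallest; left.
have GB : G (\pi_(PSL2 C) B) by apply: sub_gen_smallest; right.
have subG : is_subgroup G := is_subgroup_generated _.
have GC : G (\pi_(PSL2 C) (A * B * A^-1)%g).
  rewrite -!pi_mul -pi_inv; apply: (subgroup_div subG) => //.
  exact: (subgroupM subG).
have [n1 n1_gt0 H1] := finite_index_expg subG subH finH GA.
have [n2 n2_gt0 H2] := finite_index_expg subG subH finH GB.
have [n3 n3_gt0 H3] := finite_index_expg subG subH finH GC.
(* A common exponent lets one pair (p, q) describe the powers of f, w and f w f^-1 at once. *)
pose n := (n1 * n2 * n3)%N; have n_gt0 : (0 < n)%N by rewrite !muln_gt0 n1_gt0 n2_gt0.
have HA : H (\pi_(PSL2 C) (A ^+ n)%g).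
  by rewrite -pi_exp /n -mulnA expgnA; apply: (subgroupX subH).
have HB : H (\pi_(PSL2 C) (B ^+ n)%g).
  by rewrite -pi_exp /n [(n1 * n2)%N]mulnC -mulnA expgnA; apply: (subgroupX subH).
have HC : H (\pi_(PSL2 C) (A * B ^+ n * A^-1)%g).
  have -> : (A * B ^+ n * A^-1 = (A * B * A^-1) ^+ n)%g.
    elim: (n) => [|k IHk]; first by rewrite !expg0 mulg1 mulgV.
    by rewrite !expgS -IHk !mulgA mulgVK.
  by rewrite -pi_exp /n mulnC expgnA; apply: (subgroupX subH).
have trH D : H (\pi_(PSL2 C) D) -> trace_field H (\tr (SL2val D)).
  by move=> HD; apply: Qadjoin_mem; exists D.
have HAB : H (\pi_(PSL2 C) (A ^+ n * B ^+ n)%g).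
  by rewrite -pi_mul; apply: (subgroupM subH).
have HCB : H (\pi_(PSL2 C) (A * B ^+ n * A^-1 * B ^+ n)%g).
  by rewrite -pi_mul; apply: (subgroupM subH).
move: (trH _ HA) (trH _ HAB) (trH _ HCB).
rewrite tr_f_exp tr_fw_exp tr_conj_exp.
have := power_coefs_neq0 n_gt0; have := power_coefs_det n.
have subL : is_subfield (trace_field H) := Qadjoin_is_subfield _.
move: (power_coefs n).1 (power_coefs n).2 (trace_field H) subL.
move=> p q L subL det1 p0 Lx Ly Lz.
pose T := p * t + 2 * q.
(* The traces of F^2, F W and (f W f^-1) W, where F and W are the trace-free
   parts of f^n and w^n; conjugation by f rotates the component of W orthogonal
   to F, and the cosine of the angle is t^2 / 2 - 1. *)
pose al := p ^+ 2 * (t ^+ 2 / 2 - 2); pose be := p ^+ 2 * (t ^+ 2 / 2 - s).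
pose ga := p ^+ 2 *
  (t ^+ 2 * (t ^+ 2 - s) - t ^+ 2 - (t ^+ 2 - s) ^+ 2 + 2 - t ^+ 2 / 2).
have Lal : L al.
  have -> : al = T ^+ 2 / 2 - 2 * (q ^+ 2 + p * q * t + p ^+ 2).
    by rewrite /al /T; field.
  by rewrite det1; subfield_closure.
have Lbe : L be.
  have -> : be = p ^+ 2 * (t ^+ 2 - s) + 2 * p * q * t + 2 * q ^+ 2 - T ^+ 2 / 2.
    by rewrite /be /T; field.
  by subfield_closure.
have Lga : L ga.
  have -> : ga = p ^+ 2 * (t ^+ 2 * (t ^+ 2 - s) - t ^+ 2 - (t ^+ 2 - s) ^+ 2 + 2)
    + 2 * p * q * t + 2 * q ^+ 2 - T ^+ 2 / 2 by rewrite /ga /T; field.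
  by subfield_closure.
(* This is the Gram determinant of F and W; it equals p^4 (2 - tr [f, w]), whose second factor is
   nonzero by [s2] and [ts2]. *)
have al2be2 : al ^+ 2 - be ^+ 2 != 0.
  have -> : al ^+ 2 - be ^+ 2 = p ^+ 4 * ((s - 2) * (t ^+ 2 - s - 2)).
    by rewrite /al /be; field.
  by rewrite !mulf_neq0 ?expf_neq0 ?subr_eq0.
have Lt : L (t ^+ 2).
  (* Splitting W along F and orthogonally to it gives al ga - be^2 = (t^2 / 2 - 1) (al^2 - be^2),
     which is solved for t^2. *)
  have -> : t ^+ 2 =
      2 * (al ^+ 2 - be ^+ 2 + al * ga - be ^+ 2) / (al ^+ 2 - be ^+ 2).
    by apply: (canRL (mulfK al2be2)); rewrite /al /be /ga; field.
  by subfield_closure.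
have al0 : al != 0.
  have -> : al = p ^+ 2 * (z ^- 2 * (z ^+ 2 - 1) ^+ 2 / 2) by rewrite /al /t; field.
  rewrite !mulf_neq0 ?expf_neq0 ?invr_eq0 ?expf_neq0 ?subr_eq0 ?zX //.
  by rewrite pnatr_eq0.
move=> _ [->|->] //.
(* The ratio be / al equals (t^2 / 2 - s) / (t^2 / 2 - 2), which is affine in s once t^2 is
   known. *)
have -> : s = (t ^+ 2 / 2 * al - be * (t ^+ 2 / 2 - 2)) / al.
  by apply: (canRL (mulfK al0)); rewrite /al /be; field.
by subfield_closure.
Qed.

End LowerBound.

Lemma invariant_trace_fieldE (z s : C) (A B : SL2 C) (t := z + z^-1) :
    z != 0 -> (forall n, (0 < n)%N -> z ^+ n != 1) -> t != 0 ->
    s != 2 -> t ^+ 2 - s != 2 ->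
    SL2val A = f_mx t -> SL2val B = w_mx t t s z ->
  invariant_trace_field
    (generated_subgroup [set \pi_(PSL2 C) A; \pi_(PSL2 C) B]) =
  Qadjoin [set t ^+ 2; s].
Proof.
move=> z0 zX t0 s2 ts2 fE wE; rewrite eqEsubset; split.
  have Kt2 : Qadjoin [set t ^+ 2; s] (t ^+ 2) by apply: Qadjoin_mem; left.
  have Ks : Qadjoin [set t ^+ 2; s] s by apply: Qadjoin_mem; right.
  exact: (invariant_trace_field_sub z0 t0 fE wE (Qadjoin_is_subfield _) Kt2 Ks).
move=> x Kx H [subH _ finH].
exact: (Qadjoin_sub (Qadjoin_is_subfield _)
  (trace_field_ge z0 zX s2 ts2 fE wE subH finH)) Kx.
Qed.

End Group.

(** * Irreducibility modulo a prime *)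

Section ListPoly.
Implicit Types (l g h : seq Z) (c p : Z).

(** Polynomials are lists of binary integers, constant term first, so that the checks run by
    evaluation. *)
Fixpoint ladd l1 l2 : seq Z :=
  match l1, l2 with
  | [::], _ => l2
  | _, [::] => l1
  | c1 :: l1', c2 :: l2' => Z.add c1 c2 :: ladd l1' l2'
  end.

Definition lscale c l := map (Z.mul c) l.

Fixpoint lmul l1 l2 : seq Z :=
  if l1 is c :: l1' then ladd (lscale c l2) (Z0 :: lmul l1' l2) else [::].

Lemma Poly_cons c l : Poly (c :: l) = Poly l * 'X + c%:P :> {poly Z}.
Proof. by rewrite /= cons_poly_def. Qed.

Lemma Poly_ladd l1 l2 : Poly (ladd l1 l2) = Poly l1 + Poly l2 :> {poly Z}.
Proof.
elim: l1 l2 => [|c1 l1 IHl] [|c2 l2]; rewrite ?add0r ?addr0 //.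
by rewrite [ladd _ _]/= !Poly_cons IHl -[Z.add _ _]/(c1 + c2) polyCD; ring.
Qed.

Lemma Poly_lscale c l : Poly (lscale c l) = c *: Poly l :> {poly Z}.
Proof.
elim: l => [|a l IHl]; first by rewrite /= scaler0.
by rewrite [lscale _ _]/= !Poly_cons IHl -!mul_polyC -[Z.mul _ _]/(c * a) polyCM; ring.
Qed.

Lemma Poly_lmul l1 l2 : Poly (lmul l1 l2) = Poly l1 * Poly l2 :> {poly Z}.
Proof.
elim: l1 => [|c l1 IHl]; first by rewrite /= mul0r.
by rewrite [lmul _ _]/= Poly_ladd Poly_lscale !Poly_cons IHl -mul_polyC; ring.
Qed.

Definition residues p := map Z.of_nat (iota 0 (Z.to_nat p)).

Fixpoint residue_lists p n : seq (seq Z) :=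
  if n is n'.+1 then [seq c :: l | c <- residues p, l <- residue_lists p n']
  else [:: [::]].

Definition monic_lists p n := [seq rcons l (Zpos 1) | l <- residue_lists p n].

(* No product of monic polynomials of positive degree is congruent to l,
   by enumeration of all pairs of residues. *)
Definition irreducible_mod p l :=
  all (fun d => all (fun g => all (fun h =>
      has (fun c => ~~ Z.eqb (Z.modulo c p) Z0) (ladd (lmul g h) (lscale (Zneg 1) l)))
    (monic_lists p ((size l).-1 - d))) (monic_lists p d)) (iota 1 (size l).-2).

End ListPoly.

Section IrreducibleMod.
Variable p : Z.
Hypothesis p_gt1 : Z.lt 1 p.
Implicit Types (l g h : seq Z) (c : Z).

Lemma residue_listsP l : map (Z.modulo^~ p) l \in residue_lists p (size l).
Proof.
elim: l => [|c l IHl] //=; rewrite allpairs_f //.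
have := Z.mod_pos_bound c p; move: (Z.modulo c p) => r rP.
apply/mapP; exists (Z.to_nat r); last by lia.
rewrite mem_iota; lia.
Qed.

Lemma monic_listsP (q : {poly Z}) : q \is monic ->
  map (Z.modulo^~ p) q \in monic_lists p (size q).-1.
Proof.
rewrite monicE lead_coefE; case: q => [s /= _].
case/lastP: s => [|s c]; first by rewrite /= => /eqP.
rewrite size_rcons /= nth_rcons ltnn eqxx => /eqP ->.
rewrite map_rcons; apply/mapP; exists (map (Z.modulo^~ p) s).
  exact: residue_listsP.
by congr rcons; rewrite Z.mod_1_l.
Qed.

Lemma Poly_mod (q : {poly Z}) :
  Poly (map (Z.modulo^~ p) q) = q - p *: Poly (map (Z.div^~ p) q).
Proof.
apply/polyP=> i; rewrite coefB coefZ !coef_Poly.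
have [ltiq|leqi] := ltnP i (size q); last first.
  by rewrite !nth_default ?size_map ?mulr0 ?subr0.
rewrite !(nth_map 0) //; move: (q`_i) => c.
rewrite -[_ - _]/(Z.sub c (Z.mul p (Z.div c p))).
have cE : c = Z.add (Z.mul p (Z.div c p)) (Z.modulo c p) by apply: Z.div_mod; lia.
by rewrite /= [X in Z.sub X _]cE Z.add_simpl_l.
Qed.

(** By Gauss's lemma a divisor over the rationals gives a factorization [q = g * h] over the
    integers with [g] primitive. Both factors are then monic, so their residues modulo [p] occur in
    the enumeration. *)
Lemma irreducible_modP l : last 0 l = 1 -> irreducible_mod p l ->
  (1 < size l)%N -> irreducible_poly (map_poly int_of_Z (Poly l)).
Proof.
set q := map_poly _ _ => l1 irr size_l.
have szP : Poly l = l :> seq Z by rewrite (PolyK (c := 0)) ?l1.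
have qZ : map_poly Z_of_int q = Poly l.
  by rewrite -map_poly_comp map_poly_id // => c _; exact: int_of_ZK.
have sz_q : size q = size l.
  rewrite size_map_poly_id0 ?szP // lead_coefE szP nth_last l1 //.
have qm : q \is monic.
  rewrite monicE lead_coefE sz_q coef_map szP nth_last l1 //.
split=> [|r sz_r /dvdpP_int[h]]; first by rewrite sz_q.
set g := zprimitive r => qE.
have r0 : r != 0.
  apply: contraTneq qm => r0; rewrite qE /g r0 zprimitive0 mul0r.
  by rewrite monicE lead_coef0.
have gh1 : lead_coef g * lead_coef h = 1 by rewrite -lead_coefM -qE; apply/eqP.
have sg1 : sgz (lead_coef g) = 1 by rewrite sgz_lead_primitive r0.
have g_gt0 : 0 < lead_coef g by rewrite -sgz_gt0 sg1.
have [g1 h1] : lead_coef g = 1 /\ lead_coef h = 1.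
  have /eqP := congr1 absz gh1; rewrite abszM muln_eq1 => /andP[/eqP ag /eqP ah].
  have g1 : lead_coef g = 1 by lia.
  by split=> //; rewrite -gh1 g1 mul1r.
have sz_g : size g = size r by rewrite size_zprimitive.
have g0 : g != 0 by rewrite zprimitive_eq0.
have h0 : h != 0 by apply: contra_eq_neq h1 => ->; rewrite lead_coef0.
(* A constant monic cofactor is 1, and [r] is associate to [q]; otherwise both degrees are positive
   and the enumeration applies. *)
have [sz_h|sz_h] := eqVneq (size h) 1%N.
  have -> : q = g.
    rewrite qE -/g (size1_polyC (eq_leq sz_h)).
    by move: h1; rewrite lead_coefE sz_h /= => ->; rewrite mulr1.
  rewrite [X in X %= _]zpolyEprim; apply: eqp_scale.
  by rewrite zcontents_eq0.
have sz_qE : (size q).-1 = ((size g).-1 + (size h).-1)%N.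
  rewrite qE -/g size_mul //; move: g0 h0; rewrite -!size_poly_gt0.
  by move: (size g) (size h) => a b; lia.
pose gZ := map_poly Z_of_int g; pose hZ := map_poly Z_of_int h.
have map1 (k : {poly int}) : lead_coef k = 1 ->
    map_poly Z_of_int k \is monic /\ size (map_poly Z_of_int k) = size k.
  move=> k1; have szk : size (map_poly Z_of_int k) = size k.
    by rewrite size_map_poly_id0 ?k1.
  by split=> //; rewrite monicE lead_coefE szk coef_map -lead_coefE k1.
have [gm szg] := map1 _ g1; have [hm szh] := map1 _ h1.
have := irr; rewrite /irreducible_mod => /allP/(_ (size g).-1).
have -> : (size g).-1 \in iota 1 (size l).-2.
  rewrite mem_iota; move: sz_qE sz_q sz_r sz_h h0 r0.
  by rewrite -!size_poly_gt0 -sz_g; lia.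
move=> /(_ isT)/allP/(_ _); rewrite -{1}szg => /(_ _ (monic_listsP gm)).
have -> : ((size l).-1 - (size g).-1 = (size hZ).-1)%N by rewrite szh -sz_q sz_qE addKn.
move=> /allP/(_ _ (monic_listsP hm))/hasP[c c_in] /negP[]; apply/Z.eqb_eq.
(* Replacing each factor by its residues changes the product by a multiple of [p], so every
   coefficient of the tested difference is 0 modulo [p], against the check. *)
have [E DE] : exists E : {poly Z}, Poly (ladd
    (lmul (map (Z.modulo^~ p) gZ) (map (Z.modulo^~ p) hZ))
    (lscale (Zneg 1) l)) = p *: E.
  rewrite Poly_ladd Poly_lmul Poly_lscale !Poly_mod.
  have <- : gZ * hZ = Poly l by rewrite -rmorphM /= -qE.
  move: (Poly (map (Z.div^~ p) gZ)) (Poly (map (Z.div^~ p) hZ)) => E1 E2.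
  exists (p *: (E1 * E2) - gZ * E2 - E1 * hZ).
  by rewrite -[Zneg 1]/(- 1 : Z) -!mul_polyC rmorphN1; ring.
have [i ltiD <-] := nthP Z0 c_in.
rewrite -[nth _ _ _]/(_`_i) -coef_Poly DE coefZ mulrC.
by apply: Z.mod_mul; lia.
Qed.

End IrreducibleMod.

(** * Certified location of roots *)

Section MinimalPolynomial.
Variable F : numFieldType.

(** The gcd of [p] and [q] vanishes at [x], so it is not constant; by irreducibility it is associate
    to [p], and [p] divides [q]. *)
Lemma irreducible_minimal (p : {poly rat}) (x : F) : p \is monic ->
  irreducible_poly p -> Qroot p x -> is_minimal_polynomial p x.
Proof.
move=> p_monic p_irr px; split=> // q q0 qx.
have rg : root (map_poly ratr (gcdp p q)) x by rewrite gcdp_map root_gcd px.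
have sz_g : size (gcdp p q) != 1%N.
  apply: contraTneq rg => sz_g; have := eq_leq sz_g => /size1_polyC gE.
  move: sz_g; rewrite gE size_polyC map_polyC /= rootC fmorph_eq0.
  by case: eqP.
have gp := p_irr.2 _ sz_g (dvdp_gcdl p q).
by apply: dvdp_leq => //; rewrite -(eqp_dvdl _ gp) dvdp_gcdr.
Qed.

End MinimalPolynomial.

Section Numerics.
Variable R : realType.
Local Notation C := R[i].
Local Open Scope complex_scope.

Definition ofZ (A : pzRingType) (n : Z) : A := (int_of_Z n)%:~R.

Lemma ofZD (A : pzRingType) m n : ofZ A (Z.add m n) = ofZ A m + ofZ A n.
Proof. by rewrite /ofZ -[Z.add _ _]/(m + n) !rmorphD. Qed.

Lemma ofZM (A : pzRingType) m n : ofZ A (Z.mul m n) = ofZ A m * ofZ A n.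
Proof. by rewrite /ofZ -[Z.mul _ _]/(m * n) !rmorphM. Qed.

Lemma ofZN (A : pzRingType) m : ofZ A (Z.opp m) = - ofZ A m.
Proof. by rewrite /ofZ -[Z.opp _]/(- m) !rmorphN. Qed.

Lemma ofZ0 (A : pzRingType) : ofZ A Z0 = 0. Proof. by []. Qed.

Lemma ofZ_le (A : numDomainType) m n : Z.le m n -> ofZ A m <= ofZ A n.
Proof. by move=> le_mn; rewrite /ofZ ler_int; lia. Qed.

Lemma ofZ_lt (A : numDomainType) m n : Z.lt m n -> ofZ A m < ofZ A n.
Proof. by move=> le_mn; rewrite /ofZ ltr_int; lia. Qed.

Lemma ofZ_abs (A : numDomainType) m : ofZ A (Z.abs m) = `|ofZ A m|.
Proof.
case: (Z.abs_spec m) => -[le0m ->].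
  by rewrite ger0_norm // -(ofZ0 A) ofZ_le.
by rewrite ofZN ler0_norm // -(ofZ0 A) ofZ_le //; lia.
Qed.

Lemma ofZ_nat (A : pzRingType) n : ofZ A (Z.of_nat n) = n%:R.
Proof. by rewrite /ofZ; have -> : int_of_Z (Z.of_nat n) = n by lia. Qed.

(* A pair of integers stands for a Gaussian integer. *)
Implicit Types (g a b : Z * Z) (l : seq (Z * Z)) (x y : C).

Definition gadd a b := (Z.add a.1 b.1, Z.add a.2 b.2).
Definition gmul a b := (Z.sub (Z.mul a.1 b.1) (Z.mul a.2 b.2),
  Z.add (Z.mul a.1 b.2) (Z.mul a.2 b.1)).
(** Integer bounds for the modulus, from above here and from below in [ginf], avoid square roots. *)
Definition gsup a := Z.add (Z.abs a.1) (Z.abs a.2).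
Definition ginf a := Z.max (Z.abs a.1) (Z.abs a.2).

Definition gauss g : C := ofZ R g.1 +i* ofZ R g.2.

Lemma gaussD a b : gauss (gadd a b) = gauss a + gauss b.
Proof. by rewrite /gauss !ofZD. Qed.

Lemma gaussM a b : gauss (gmul a b) = gauss a * gauss b.
Proof.
rewrite /gauss /= /Z.sub !ofZD ofZN !ofZM.
by apply/eqP; rewrite eq_complex /= eqxx /=; apply/eqP; ring.
Qed.

Lemma ofZ_complex m : ofZ C m = (ofZ R m)%:C.
Proof. by rewrite /ofZ rmorph_int. Qed.

Lemma gauss_ofZ m : gauss (m, Z0) = ofZ C m.
Proof. by rewrite ofZ_complex /gauss /= ofZ0. Qed.

Lemma normc_i : `|'i%C| = 1 :> C.
Proof.
rewrite normc_def /=.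
by rewrite expr0n /= expr1n add0r sqrtr1.
Qed.

Lemma gauss_le a : `|gauss a| <= ofZ C (gsup a).
Proof.
rewrite /gauss [_ +i* _]complexE /= ofZD !ofZ_abs !ofZ_complex.
by apply: le_trans (ler_normD _ _) _; rewrite normrM normc_i mul1r.
Qed.

Lemma gauss_ge a : ofZ C (ginf a) <= `|gauss a|.
Proof.
rewrite /ginf; case: (Z.max_spec (Z.abs a.1) (Z.abs a.2)) => -[_ ->].
  have := normc_ge_Re (gauss a * 'i); rewrite ReiNIm normrN normrM normc_i mulr1.
  by rewrite -ofZ_abs -ofZ_complex.
by have := normc_ge_Re (gauss a); rewrite -ofZ_abs -ofZ_complex.
Qed.

Fixpoint gladd l1 l2 : seq (Z * Z) :=
  match l1, l2 with
  | [::], _ => l2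
  | _, [::] => l1
  | c1 :: l1', c2 :: l2' => gadd c1 c2 :: gladd l1' l2'
  end.

Fixpoint zpow (N : Z) n : Z := if n is n'.+1 then Z.mul N (zpow N n') else Zpos 1.

(* The expansion at a / N in the variable y = N x - a, scaled by N ^ size l so
   that it is integral: see geval_taylor. *)
Fixpoint gtaylor l a N : seq (Z * Z) :=
  if l is c :: l' then
    let r := gtaylor l' a N in
    gladd [:: gmul (zpow N (size l), Z0) c] (gladd (map (gmul a) r) ((Z0, Z0) :: r))
  else [::].

Fixpoint geval l x : C := if l is c :: l' then gauss c + x * geval l' x else 0.

Lemma gauss0 : gauss (Z0, Z0) = 0.
Proof. by rewrite gauss_ofZ. Qed.

Lemma geval_add l1 l2 x : geval (gladd l1 l2) x = geval l1 x + geval l2 x.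
Proof.
elim: l1 l2 => [|c1 l1 IHl] [|c2 l2]; rewrite ?add0r ?addr0 //=.
by rewrite IHl gaussD; ring.
Qed.

Lemma geval_scale a l x : geval (map (gmul a) l) x = gauss a * geval l x.
Proof.
elim: l => [|c l IHl] /=; first by rewrite mulr0.
by rewrite IHl gaussM; ring.
Qed.

Lemma ofZ_zpow N n : ofZ C (zpow N n) = ofZ C N ^+ n.
Proof. by elim: n => [|n IHn] //=; rewrite ofZM IHn exprS. Qed.

(** Horner's rule scaled: for x = (a + y) / N, N^(n+1) (c + x l(x)) = N^(n+1) c + (a + y) N^n
    l(x). *)
Lemma geval_taylor l a N y : ofZ C N != 0 ->
  geval (gtaylor l a N) y =
  ofZ C N ^+ size l * geval l ((gauss a + y) / ofZ C N).
Proof.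
move=> N0; elim: l => [|c l IHl]; first by rewrite /= mulr0.
have -> : gtaylor (c :: l) a N = gladd [:: gmul (zpow N (size l).+1, Z0) c]
    (gladd (map (gmul a) (gtaylor l a N)) ((Z0, Z0) :: gtaylor l a N)) by [].
rewrite !geval_add geval_scale /= gauss0 mulr0 IHl gaussM gauss_ofZ ofZM ofZ_zpow.
by rewrite exprS; field.
Qed.

Fixpoint gbound l (D : Z) : Z :=
  if l is c :: l' then Z.add (gsup c) (Z.mul D (gbound l' D)) else Z0.

(** The derivative at [D] of the majorant polynomial whose value is [gbound l D]. *)
Fixpoint gdbound l (D : Z) : Z :=
  if l is c :: l' then Z.add (gbound l' D) (Z.mul D (gdbound l' D)) else Z0.

Lemma geval_le l D y : `|y| <= ofZ C D -> `|geval l y| <= ofZ C (gbound l D).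
Proof.
move=> leyD; elim: l => [|c l IHl] /=; first by rewrite normr0.
rewrite ofZD ofZM; apply: le_trans (ler_normD _ _) _; rewrite normrM.
by apply: lerD; [exact: gauss_le | apply: ler_pM].
Qed.

(** The divided difference of [geval l], in a division-free form that makes sense for x = y too. *)
Fixpoint gdiff l x y : C :=
  if l is c :: l' then geval l' x + y * gdiff l' x y else 0.

Lemma gdiffE l x y : geval l x - geval l y = (x - y) * gdiff l x y.
Proof.
elim: l => [|c l IHl] /=; first by rewrite subrr mulr0.
rewrite mulrDr mulrCA -IHl; ring.
Qed.

Lemma gdiff_le l D x y : `|x| <= ofZ C D -> `|y| <= ofZ C D ->
  `|gdiff l x y| <= ofZ C (gdbound l D).
Proof.
move=> lexD leyD; elim: l => [|c l IHl] /=; first by rewrite normr0.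
rewrite ofZD ofZM; apply: le_trans (ler_normD _ _) _; rewrite normrM.
by apply: lerD; [exact: geval_le | apply: ler_pM].
Qed.

(* p(x) - p(y) = (x - y) (p'(0) + r) with |r| bounded on the disk of radius D. *)
Definition separated_roots l D :=
  if l is _ :: e1 :: l' then
    Z.ltb (Z.mul D (Z.add (gbound l' D) (gdbound (e1 :: l') D))) (ginf e1)
  else false.

Lemma separated_rootsP l D x y : separated_roots l D ->
  geval l x = 0 -> geval l y = 0 -> `|x| <= ofZ C D -> `|y| <= ofZ C D -> x = y.
Proof.
case: l => [|e0 [|e1 l]] //= /Z.ltb_lt sep lx ly lexD leyD.
have := gdiffE (e0 :: e1 :: l) x y; rewrite [geval _ x]lx [geval _ y]ly subrr.
move/esym/eqP; rewrite mulf_eq0 => /orP[|/eqP]; first by rewrite subr_eq0 => /eqP.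
rewrite [gdiff _ _ _]/= -addrA => /eqP; rewrite addr_eq0 => /eqP e1E.
have := gauss_ge e1; rewrite e1E normrN => le_e1.
have := le_trans le_e1 (ler_normD _ _); rewrite !normrM.
have := ofZ_lt C sep; rewrite /= ofZM ofZD => ltD.
move=> leD; have := lt_le_trans ltD leD; rewrite le_gtF //.
rewrite mulrDr; apply: lerD; apply: ler_pM => //; first exact: geval_le.
exact: (@gdiff_le (e1 :: l)).
Qed.

(** The logarithmic derivative at [a] is the sum of the 1 / (a - r), each of modulus at most 1 / d.
    Clearing denominators permits an induction by the product rule, with no case for vanishing
    factors. *)
Lemma prod_deriv_le (rs : seq C) (a d : C) : 0 <= d ->
    (forall r, r \in rs -> d <= `|a - r|) ->
  let p := \prod_(r <- rs) ('X - r%:P) in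
  `|p^`().[a]| * d <= (size rs)%:R * `|p.[a]|.
Proof.
move=> d_ge0; elim: rs => [|r rs IHrs] far /=.
  by rewrite big_nil derivC horner0 normr0 !mul0r.
rewrite big_cons; set p := \prod_(j <- rs) _ in IHrs *.
have {}IHrs : `|p^`().[a]| * d <= (size rs)%:R * `|p.[a]|.
  by apply: IHrs => r' r'rs; apply: far; rewrite inE r'rs orbT.
have ler : d <= `|a - r| by apply: far; rewrite inE eqxx.
rewrite derivM derivXsubC mul1r hornerD !hornerM hornerXsubC normrM.
apply: le_trans (ler_wpM2r d_ge0 (ler_normD _ _)) _.
rewrite normrM mulrDl -mulrA -natr1 mulrDl mul1r addrC.
apply: lerD; last by rewrite [leLHS]mulrC; apply: ler_wpM2r.
by rewrite [leRHS]mulrCA; apply: ler_wpM2l.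
Qed.

Definition gpoly l : {poly C} := Poly (map gauss l).

Lemma horner_gpoly l x : (gpoly l).[x] = geval l x.
Proof.
rewrite horner_Poly; elim: l => [|c l IHl] //=.
by rewrite IHl; ring.
Qed.

(* If all roots r of p satisfy d <= |r|, then |p'(0)| d <= deg p |p(0)|,
   since p'/p is the sum of the 1 / (x - r). *)
Definition near_root l D :=
  if l is e0 :: e1 :: _ then
    Z.leb 0 D && Z.ltb (Z.mul (Z.of_nat (size l)) (gsup e0)) (Z.mul (ginf e1) D)
  else false.

Lemma near_rootP l D : near_root l D ->
  exists2 x, geval l x = 0 & `|x| <= ofZ C D.
Proof.
move=> near; apply: contrapT => none.
have far x : root (gpoly l) x -> ofZ C D <= `|0 - x|.
  rewrite sub0r normrN rootE horner_gpoly => /eqP lx.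
  have D_real : ofZ C D \is Num.real by rewrite /ofZ realz.
  have /orP[//|lexD] := real_leVge D_real (normr_real x).
  by case: none; exists x.
case: l near none far => [|e0 [|e1 l]] //.
rewrite /near_root; move sE : (size _) => n /andP[].
move=> /Z.leb_le D_ge0 /Z.ltb_lt lt_e none far.
pose p := gpoly [:: e0, e1 & l].
have p0E : p.[0] = gauss e0 by rewrite horner_gpoly /= mul0r addr0.
have p1E : p^`().[0] = gauss e1.
  by rewrite horner_coef0 coef_deriv mulr1n coef_Poly.
have size_p : (size p <= n)%N.
  by rewrite -sE -(size_map gauss) size_Poly.
have [rs pE] := closed_field_poly_normal p.
have D_ge0' : 0 <= ofZ C D by rewrite -(ofZ0 C) ofZ_le.
(* For p = 0 the coefficient [e1] would vanish, while the check forces [ginf e1] to be positive. *)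
have p_neq0 : p != 0.
  apply/eqP => p0; have := gauss_ge e1; rewrite -p1E p0 derivC horner0 normr0.
  rewrite lt_geF // -(ofZ0 C) ofZ_lt //.
  have : Z.le 0 (gsup e0) by rewrite /gsup; lia.
  by move: (gsup e0) (ginf e1) lt_e => b c; nia.
have size_rs : (size rs <= n)%N.
  apply: leq_trans size_p; rewrite pE size_scale ?lead_coef_eq0 //.
  by rewrite size_prod_XsubC.
have far' r : r \in rs -> ofZ C D <= `|0 - r|.
  move=> r_rs; apply: far; rewrite -/p pE rootZ ?lead_coef_eq0 //.
  by rewrite root_prod_XsubC.
(* Multiplying by the leading coefficient passes from the monic product to [p]; the number of roots
   is bounded by the length [n] of the list. *)
have := ler_wpM2l (normr_ge0 (lead_coef p)) (prod_deriv_le D_ge0' far').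
rewrite mulrA mulrCA -!normrM -!hornerZ -derivZ -pE p0E p1E.
have := ofZ_lt C lt_e; rewrite !ofZM ofZ_nat => lt1 le1.
suff /(lt_le_trans lt1) : ofZ C (ginf e1) * ofZ C D <=
    n%:R * ofZ C (gsup e0) by rewrite ltxx.
apply: le_trans (ler_wpM2r D_ge0' (gauss_ge e1)) _; apply: le_trans le1 _.
by apply: ler_pM => //; rewrite ?ler_nat //; apply: gauss_le.
Qed.

Definition zpoly (l : seq Z) : seq (Z * Z) := map (pair^~ Z0) l.

(* 2 N z^2 (tau' - b / N) as a polynomial in z,
   where 2 tau' = e0 + e1 t + e2 t^2 and t = z + 1 / z. *)
Definition tau_gap (b : Z * Z) (N e0 e1 e2 : Z) : seq (Z * Z) :=
  let u := gadd (Z.mul (Z.add e0 (Z.mul (Zpos 2) e2)) N, Z0) (gmul (Zneg 2, Z0) b) in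
  [:: (Z.mul e2 N, Z0); (Z.mul e1 N, Z0); u; (Z.mul e1 N, Z0); (Z.mul e2 N, Z0)].

(* D and D' are radii in the unit 1 / N. *)
Definition certified (lz lq : seq Z) (a b : Z * Z) (N D D' e0 e1 e2 : Z) : bool :=
  [&& Z.ltb 0 N, near_root (gtaylor (zpoly lz) a N) D, Z.ltb (Z.add N D) (ginf a),
      Z.leb (gbound (gtaylor (tau_gap b N e0 e1 e2) a N) D)
            (Z.mul (zpow N 5) (Z.mul (Zpos 2) D'))
    & separated_roots (gtaylor (zpoly lq) b N) D'].

(** Some root lies within D / N of a / N, hence so does the nearest root [z], and |z| > 1 follows.
    On that disk the bound on [tau_gap] puts [tau'] within D' / N of b / N; the nearest root [tau]
    is at least as close, and that disk contains only one root. *)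
Lemma certifiedP lz lq a b N D D' e0 e1 e2 z tau :
    certified lz lq a b N D D' e0 e1 e2 ->
    let tau' := (ofZ C e0 + ofZ C e1 * (z + z^-1) + ofZ C e2 * (z + z^-1) ^+ 2) / 2 in
    geval (zpoly lz) z = 0 ->
    (forall y, geval (zpoly lz) y = 0 ->
      `|z - gauss a / ofZ C N| <= `|y - gauss a / ofZ C N|) ->
    geval (zpoly lq) tau = 0 ->
    (forall y, geval (zpoly lq) y = 0 ->
      `|tau - gauss b / ofZ C N| <= `|y - gauss b / ofZ C N|) ->
  geval (zpoly lq) tau' = 0 -> 1 < `|z| /\ tau = tau'.
Proof.
case/and5P=> /Z.ltb_lt N_gt0 /near_rootP[x lx lexD] /Z.ltb_lt ltND /Z.leb_le gapD sep.
move=> tau' lzz z_near lqtau tau_near lqtau'.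
have N_gt0' : 0 < ofZ C N by rewrite -(ofZ0 C) ofZ_lt.
have N0 : ofZ C N != 0 by rewrite gt_eqF.
have N_norm : `|ofZ C N| = ofZ C N by rewrite gtr0_norm.
have rescale (c w : C) : ofZ C N * `|w - c / ofZ C N| = `|ofZ C N * w - c|.
  by rewrite -{1}N_norm -normrM mulrBr mulrCA divff // mulr1.
have shift (c w : C) : (c + (ofZ C N * w - c)) / ofZ C N = w by field.
pose y := ofZ C N * z - gauss a.
have leyD : `|y| <= ofZ C D.
  (* The root [x] is in the scaled variable; (a + x) / N is a root of the original polynomial. *)
  rewrite geval_taylor // in lx; move/eqP: lx.
  rewrite mulf_eq0 expf_eq0 (negPf N0) andbF /= => /eqP /z_near le_zx.
  apply: le_trans lexD; rewrite -rescale.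
  apply: le_trans (ler_wpM2l (ltW N_gt0') le_zx) _.
  by rewrite rescale mulrCA divff // mulr1 addrC addKr.
have z_gt1 : 1 < `|z|.
  rewrite -(ltr_pM2l N_gt0') mulr1 -{2}N_norm -normrM.
  have -> : ofZ C N * z = gauss a - - y by rewrite /y; ring.
  apply: lt_le_trans (lerB_dist _ _); rewrite normrN ltrBrDr.
  apply: le_lt_trans (lerD (lexx _) leyD) _.
  by rewrite -ofZD; apply: lt_le_trans (ofZ_lt _ ltND) (gauss_ge _).
have z0 : z != 0 by rewrite -normr_gt0 (lt_trans ltr01).
split=> //.
have gapE : geval (tau_gap b N e0 e1 e2) z = 2 * z ^+ 2 * (ofZ C N * tau' - gauss b).
  have geval_cons c l w : geval (c :: l) w = gauss c + w * geval l w by [].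
  rewrite /tau_gap !geval_cons gaussD gaussM !gauss_ofZ !ofZM ofZD ofZM /tau'.
  rewrite -[ofZ C (Zneg 2)]/(- 2) -[ofZ C (Zpos 2)]/(2 : C) /=; by field.
have le_gap : `|ofZ C N * tau' - gauss b| <= ofZ C D'.
  have := geval_le (gtaylor (tau_gap b N e0 e1 e2) a N) leyD.
  rewrite geval_taylor // shift gapE (normrM (_ ^+ _)) (normrM (2 * _)) (normrM 2).
  rewrite !normrX N_norm.
  (* The power N^5 comes from the five coefficients of [tau_gap]; it cancels together with 2, and
     |z|^2 >= 1 removes the remaining factor. *)
  move=> /le_trans/(_ (ofZ_le _ gapD)); rewrite ofZM ofZ_zpow ler_pM2l ?exprn_gt0 //.
  rewrite ofZM -[ofZ C (Zpos 2)]/(2 : C) normr_nat -mulrA ler_pM2l ?ltr0n //.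
  by apply: le_trans; rewrite ler_peMl // exprn_ege1 // ltW.
have : ofZ C N * tau - gauss b = ofZ C N * tau' - gauss b.
  apply: (separated_rootsP sep); rewrite ?geval_taylor ?shift ?lqtau ?lqtau' ?mulr0 //.
  apply: le_trans le_gap; rewrite -!rescale.
  by apply: ler_wpM2l; [exact: ltW | exact: tau_near].
by move/addIr/(mulfI N0).
Qed.
End Numerics.

(** * Integer polynomials and the field Q(tau) *)

Section IntPoly.
Variable R : realType.
Local Notation C := R[i].
Local Open Scope complex_scope.
Implicit Types (l : seq int) (x z tau : C).

Definition qpoly l : {poly rat} := map_poly intr (Poly l).

Lemma qpoly_cons c l : qpoly (c :: l) = qpoly l * 'X + c%:~R.
Proof.
by rewrite /qpoly /= cons_poly_def rmorphD rmorphM /= map_polyX map_polyC /= rmorph_int.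
Qed.

Lemma qpoly_nil : qpoly [::] = 0.
Proof. by rewrite /qpoly /= rmorph0. Qed.

Lemma QrootE (p : {poly rat}) x : Qroot p x <-> Qeval x p = 0.
Proof. by split=> [/rootP|/rootP]. Qed.

Lemma Qeval_qpoly l x : Qeval x (qpoly l) = geval (zpoly (map Z_of_int l)) x.
Proof.
rewrite /Qeval; elim: l => [|c l IHl]; first by rewrite qpoly_nil rmorph0 horner0.
rewrite qpoly_cons rmorphD rmorphM /= map_polyX rmorph_int !hornerE /= IHl.
rewrite gauss_ofZ /ofZ Z_of_intK addrC mulrC.
by rewrite -[X in X + _]/(_.[_]) -(rmorph_int polyC) hornerC.
Qed.

Lemma Poly_Z_of_int l : map_poly int_of_Z (Poly (map Z_of_int l)) = Poly l.
Proof.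
apply/polyP=> i; rewrite coef_map_id0 // !coef_Poly.
have [lti|lei] := ltnP i (size l); last by rewrite !nth_default ?size_map.
by rewrite (nth_map 0) // Z_of_intK.
Qed.

Lemma irreducible_qpoly p l : Z.lt 1 p -> last 0 l = 1 ->
  irreducible_mod p (map Z_of_int l) -> (1 < size l)%N -> irreducible_poly (qpoly l).
Proof.
move=> p1 l1 irr sz_l; apply/irreducible_rat_int; rewrite -Poly_Z_of_int.
by apply: irreducible_modP irr _; rewrite ?size_map // (last_map _ _ 0) l1.
Qed.

Lemma qpoly_size l : last 0 l = 1 -> size (qpoly l) = size l.
Proof. by move=> l1; rewrite size_rat_int_poly (PolyK (c := 0)) ?l1. Qed.

Lemma qpoly_monic l : last 0 l = 1 -> qpoly l \is monic.
Proof.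
move=> l1; rewrite monicE lead_coefE qpoly_size // coef_map coef_Poly nth_last.
by case: l l1 => [|c l] //= ->.
Qed.

(** Otherwise X - m would be an annihilator of smaller degree. This later excludes the degenerate
    values of t and s. *)
Lemma minimal_neq_int (p : {poly rat}) tau (m : int) :
  is_minimal_polynomial p tau -> (2 < size p)%N -> tau != m%:~R.
Proof.
move=> [_ _ pmin] sz_p; apply/eqP => tauE.
have rt : Qroot ('X - m%:~R%:P) tau.
  by rewrite /Qroot rmorphB /= map_polyX map_polyC /= ratr_int root_XsubC tauE.
have := pmin _ (monic_neq0 (monicXsubC _)) rt.
by rewrite size_XsubC leqNgt sz_p.
Qed.

Definition billion := Zpos 1000000000.

Definition decZ (u a b c : nat) : Z :=
  Z.add (Z.add (Z.add (Z.mul (Z.of_nat u) billion)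
                      (Z.mul (Z.of_nat a) (Zpos 1000000)))
               (Z.mul (Z.of_nat b) (Zpos 1000))) (Z.of_nat c).

Lemma ofZ1000 (A : pzRingType) : ofZ A (Zpos 1000) = 10 ^+ 3.
Proof. by rewrite -natrX. Qed.

Lemma decE u a b c : ofZ R (decZ u a b c) / ofZ R billion = dec R u a b c.
Proof.
rewrite /decZ /dec !ofZD !ofZM !ofZ_nat.
have -> : ofZ R billion = 10 ^+ 9.
  (* Splitting into factors 1000 keeps every numeral that is converted to unary small. *)
  rewrite -[billion]/(Z.mul (Zpos 1000) (Z.mul (Zpos 1000) (Zpos 1000))).
  by rewrite !ofZM ofZ1000 -!exprD.
have -> : ofZ R (Zpos 1000000) = 10 ^+ 6.
  by rewrite -[Zpos 1000000]/(Z.mul (Zpos 1000) (Zpos 1000)) !ofZM ofZ1000 -!exprD.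
by rewrite ofZ1000; field.
Qed.

Lemma gauss_dec (a b : Z) :
  gauss R (a, b) / ofZ C billion =
  (ofZ R a / ofZ R billion) +i* (ofZ R b / ofZ R billion).
Proof.
rewrite ofZ_complex -fmorphV /gauss.
by apply/eqP; rewrite eq_complex /= !mulr0 subr0 add0r !eqxx.
Qed.

(* The suffixes give the signs of the two coordinates. *)
Lemma gauss_dec_pn u a b c u' a' b' c' :
  gauss R (decZ u a b c, Z.opp (decZ u' a' b' c')) / ofZ C billion =
  dec R u a b c -i* dec R u' a' b' c'.
Proof. by rewrite gauss_dec ofZN mulNr !decE. Qed.

Lemma gauss_dec_np u a b c u' a' b' c' :
  gauss R (Z.opp (decZ u a b c), decZ u' a' b' c') / ofZ C billion =
  (- dec R u a b c) +i* dec R u' a' b' c'.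
Proof. by rewrite gauss_dec ofZN mulNr !decE. Qed.

Lemma gauss_dec_pp u a b c u' a' b' c' :
  gauss R (decZ u a b c, decZ u' a' b' c') / ofZ C billion =
  dec R u a b c +i* dec R u' a' b' c'.
Proof. by rewrite gauss_dec !decE. Qed.

Lemma gauss_dec_0p u a b c :
  gauss R (Z0, decZ u a b c) / ofZ C billion = 0 +i* dec R u a b c.
Proof. by rewrite gauss_dec decE ofZ0 mul0r. Qed.

Lemma gauss_dec_i : gauss R (Z0, billion) / ofZ C billion = 0 +i* 1.
Proof.
have billion_gt0 : ofZ R Z0 < ofZ R billion by exact: ofZ_lt.
by rewrite gauss_dec ofZ0 mul0r divff // gt_eqF.
Qed.

Lemma tr1E i z : Qeval z (z_poly (data R i)) = 0 ->
  z != 0 /\ tr1 (data R i) z = z + z^-1.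
Proof.
move=> /QrootE hz; have zt := z_rel hz.
have z0 : z != 0 by apply: contra_eq_neq zt => ->; rewrite mul0r eq_sym oner_neq0.
split=> //; apply: (mulfI z0); rewrite mulrDr mulfV // -zt; ring.
Qed.

Section Case.
Variables (i : 'I_7) (lz lq : seq int) (a b : Z * Z) (N e0 e1 e2 p : Z).
Local Notation dat := (data R i).
Hypotheses (zE : z_poly dat = qpoly lz) (tauE : tau_poly dat = qpoly lq).
Hypotheses (aE : z_approx dat = gauss R a / ofZ C N)
           (bE : tau_approx dat = gauss R b / ofZ C N).
(** The radii 20 / N and 1000 / N allow for the rounding of the decimals: the first also for the
    factor lost in [near_root], the second for the growth of tau as a function of z. *)
Hypothesis cert : certified (map Z_of_int lz) (map Z_of_int lq) a b N
  (Zpos 20) (Zpos 1000) e0 e1 e2.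
Hypotheses (p1 : Z.lt 1 p) (lq1 : last 0 lq = 1) (lq2 : (2 < size lq)%N).
Hypothesis irr : irreducible_mod p (map Z_of_int lq).

Variable T : C -> C.
Hypothesis TE : forall t, (ofZ C e0 + ofZ C e1 * t + ofZ C e2 * t ^+ 2) / 2 = T t.
Hypothesis T_root : forall z, z != 0 -> Qeval z (z_poly dat) = 0 ->
  Qeval (T (z + z^-1)) (tau_poly dat) = 0.

(** All that the seven cases take from the numerical data: afterwards only algebraic relations
    between z, t, s and tau are used. *)
Lemma nearest_roots z tau :
  is_nearest_root (z_poly dat) (z_approx dat) z ->
  is_nearest_root (tau_poly dat) (tau_approx dat) tau ->
  [/\ is_minimal_polynomial (tau_poly dat) tau,
      forall m : int, tau != m%:~R, 1 < `|z| & tau = T (tr1 dat z)].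
Proof.
move=> [/QrootE z_root z_near] [/QrootE t_root t_near].
have tau_min : is_minimal_polynomial (tau_poly dat) tau.
  apply: irreducible_minimal; last exact/QrootE.
    by rewrite tauE qpoly_monic.
  by rewrite tauE; apply: irreducible_qpoly irr _ => //; apply: ltnW.
have [z0 ->] := tr1E z_root.
have [z_gt1 tauzE] : 1 < `|z| /\ tau = T (z + z^-1).
  rewrite -TE; apply: (certifiedP cert); rewrite ?TE -?Qeval_qpoly -?zE -?tauE //;
    rewrite -?aE -?bE //.
  - by move=> y; rewrite -Qeval_qpoly -zE => /QrootE/z_near.
  - by move=> y; rewrite -Qeval_qpoly -tauE => /QrootE/t_near.
  exact: T_root.
split=> // m; apply: minimal_neq_int tau_min _.
by rewrite tauE qpoly_size.
Qed.

End Case.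

Lemma norm_gt1_expr z n : 1 < `|z| -> (0 < n)%N -> z ^+ n != 1.
Proof.
move=> z_gt1 n_gt0; apply/eqP => zn1.
have : 1 < `|z| ^+ n by rewrite exprn_egt1 // -lt0n.
by rewrite -normrX zn1 normr1 ltxx.
Qed.

Lemma invariant_trace_field_case (i : 'I_7) z tau (hz : Qroot (z_poly (data R i)) z)
    (t := tr1 (data R i) z) (s := tr3 (data R i) z) :
    1 < `|z| -> t != 0 -> s != 2 -> t ^+ 2 - s != 2 ->
    Qadjoin [set tau] (t ^+ 2) -> Qadjoin [set tau] s ->
    Qadjoin [set t ^+ 2; s] tau ->
  invariant_trace_field (Ggroup hz) = Qadjoin [set tau].
Proof.
rewrite {}/t => z_gt1; have [z0 tE] := tr1E (proj1 (QrootE _ _) hz).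
rewrite tE => t0 s2 ts2 Kt Ks Ktau.
rewrite /Ggroup (@invariant_trace_fieldE R z s) //.
- rewrite eqEsubset; split; apply: Qadjoin_sub; try exact: Qadjoin_is_subfield.
    by move=> _ [->|->].
  by move=> _ ->.
- by move=> n; apply: norm_gt1_expr.
- by rewrite /= tE.
by rewrite /= tE.
Qed.

(** * Comparison of Q(t^2, s) with Q(tau) *)

Section FieldCases.
Variables (i : 'I_7) (z tau : C) (hz : Qroot (z_poly (data R i)) z).
Let t := tr1 (data R i) z.
Let s := tr3 (data R i) z.
Hypotheses (z_gt1 : 1 < `|z|) (tau_int : forall m : int, tau != m%:~R).

(** For s = t the excluded equations are t = 0, t = 2 and (t - 2) (t + 1) = 0, all with integer
    solutions. *)
Lemma trace_field_eq_tr : s = t -> (forall m : int, t != m%:~R) ->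
  Qadjoin [set tau] t -> Qadjoin [set t ^+ 2; s] tau ->
  invariant_trace_field (Ggroup hz) = Qadjoin [set tau].
Proof.
move=> st tNint Kt Ltau.
apply: invariant_trace_field_case => //; rewrite -/t -/s ?st //.
- exact: (tNint 0).
- exact: (tNint 2).
- rewrite -subr_eq0; have -> : t ^+ 2 - t - 2 = (t - 2) * (t + 1) by ring.
  rewrite mulf_neq0 ?subr_eq0 ?(tNint 2) // -(opprK 1) subr_eq0; exact: (tNint (-1)).
exact: (subfieldX (Qadjoin_is_subfield _)).
Qed.

(** The situation of the groups 1, 2 and 4. *)
Lemma trace_field_linear : s = t -> tau = 1 - t ->
  invariant_trace_field (Ggroup hz) = Qadjoin [set tau].
Proof.
move=> st tauE; have tE : t = 1 - tau by rewrite tauE; ring.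
have subK S : is_subfield (Qadjoin S) := @Qadjoin_is_subfield C S.
apply: trace_field_eq_tr => // [m||].
- by apply: contra_neq (tau_int (1 - m)) => tm; rewrite tauE tm rmorphB.
- by rewrite tE; apply: (subfieldB (subK _) (subfield1 (subK _))); apply: Qadjoin_mem.
have -> : tau = 1 - s by rewrite st.
by apply: (subfieldB (subK _) (subfield1 (subK _))); apply: Qadjoin_mem; right.
Qed.

(** For the group 3. Here tau yields only t^2 directly, so the membership of t in Q(tau) is a
    separate hypothesis. *)
Lemma trace_field_quadratic : s = t -> tau = t ^+ 2 - 2 -> Qadjoin [set tau] t ->
  invariant_trace_field (Ggroup hz) = Qadjoin [set tau].
Proof.
move=> st tauE Kt; apply: trace_field_eq_tr => // [m|].
  apply: contra_neq (tau_int (m ^+ 2 - 2)) => tm.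
  by rewrite tauE tm rmorphB rmorphXn.
have -> : tau = t ^+ 2 - 2%:R by [].
apply: (subfieldB (Qadjoin_is_subfield _)).
  by apply: Qadjoin_mem; left.
exact: (subfield_nat (Qadjoin_is_subfield _)).
Qed.

(** For the groups 0, 5 and 6: t^2 - s = s, both fields are Q(s), and s is not an integer because
    tau is not. *)
Lemma trace_field_square (c d : int) : d != 0 -> 2 * s = t ^+ 2 ->
  tau = c%:~R + d%:~R * s ->
  invariant_trace_field (Ggroup hz) = Qadjoin [set tau].
Proof.
move=> d0 st tauE; have d0' : d%:~R != 0 :> C by rewrite intr_eq0.
have sE : s = (tau - c%:~R) / d%:~R by rewrite tauE; field.
have sNint (m : int) : s != m%:~R.
  apply: contra_neq (tau_int (c + d * m)) => sm.
  by rewrite tauE sm rmorphD rmorphM.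
have subK : is_subfield (Qadjoin [set tau]) := Qadjoin_is_subfield _.
have subL : is_subfield (Qadjoin [set t ^+ 2; s]) := Qadjoin_is_subfield _.
have Ktau : Qadjoin [set tau] tau by exact: Qadjoin_mem.
have Ls : Qadjoin [set t ^+ 2; s] s by apply: Qadjoin_mem; right.
have Ks : Qadjoin [set tau] s.
  by rewrite sE; move: (Qadjoin _) subK Ktau => K *; subfield_closure.
apply: invariant_trace_field_case => //; rewrite -/t -/s.
- apply: contra_neq (sNint 0) => t0; apply: (mulfI (_ : 2 != 0 :> C)).
    by rewrite pnatr_eq0.
  by rewrite st t0 expr0n mulr0.
- exact: (sNint 2).
- have -> : t ^+ 2 - s = s by rewrite -st; ring.
  exact: (sNint 2).
- by rewrite -st; move: (Qadjoin _) subK Ks => K *; subfield_closure.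
by rewrite tauE; move: (Qadjoin _) subL Ls => K *; subfield_closure.
Qed.

End FieldCases.

Lemma Qeval_nil x : Qeval x (qpoly [::]) = 0.
Proof. by rewrite Qeval_qpoly. Qed.

Lemma Qeval_cons x c l : Qeval x (qpoly (c :: l)) = Qeval x (qpoly l) * x + c%:~R.
Proof. by rewrite !Qeval_qpoly /= gauss_ofZ /ofZ Z_of_intK addrC mulrC. Qed.

Lemma subfield_Qeval (K : set C) x l : is_subfield K -> K x -> K (Qeval x (qpoly l)).
Proof.
move=> subK Kx; elim: l => [|c l IHl]; first by rewrite Qeval_nil; apply: subfield0.
by rewrite Qeval_cons; subfield_closure.
Qed.

Lemma qpoly_neq0 c l : c != 0 -> qpoly (c :: l) != 0.
Proof.
move=> c0; apply: contra_neq c0 => l0; apply/eqP.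
rewrite -(intr_eq0 rat) -(coef0 _ 0) -l0 qpoly_cons coefD coefMX -(rmorph_int polyC).
by rewrite coefC add0r.
Qed.

Definition QevalE := (Qeval_cons, Qeval_nil).

End IntPoly.

(** * The seven groups *)

Section Cases.
Variable R : realType.
Local Notation C := R[i].
Local Open Scope complex_scope.

Definition theorem4_at (i : 'I_7) : Prop :=
  forall (z tau : C)
    (hz : is_nearest_root (z_poly (data R i)) (z_approx (data R i)) z)
    (htau : is_nearest_root (tau_poly (data R i)) (tau_approx (data R i)) tau),
  is_minimal_polynomial (tau_poly (data R i)) tau /\
  invariant_trace_field (Ggroup (proj1 hz)) = Qadjoin [set tau].

Definition z_coefs0 : seq int :=
  [:: 1; 0; 2; 0; 6; 0; 2; 0; 1]%Z.
Definition tau_coefs0 : seq int := [:: 3; 0; 1]%Z.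
Definition z_dec0 := (decZ 0 853 230 697, Z.opp (decZ 1 252 448 658)).
(** Numerators over 10^9; a block of digits such as 050 is written 50. *)
Definition tau_dec0 := (Z0, decZ 1 732 50 808).

(** The last three arguments are the coefficients of 2 tau in powers of t, here 2 tau = 2 - 2 t^2;
    the other cases follow the same pattern. *)
Lemma certified0 : certified (map Z_of_int z_coefs0) (map Z_of_int tau_coefs0)
  z_dec0 tau_dec0 billion (Zpos 20) (Zpos 1000) (Zpos 2) Z0 (Zneg 2).
Proof. by vm_compute. Qed.

(** The polynomial is a square modulo 2 and modulo 3, while -3 is a nonresidue modulo 5. *)
Lemma irreducible0 : irreducible_mod (Zpos 5) (map Z_of_int tau_coefs0).
Proof. by vm_compute. Qed.

Definition z_coefs1 : seq int :=
  [:: 1; -2; 5; -4; 7; -4; 5; -2; 1]%Z.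
Definition tau_coefs1 : seq int := [:: 1; -2; 1; -2; 1]%Z.
Definition z_dec1 := (decZ 0 904 47 196, Z.opp (decZ 1 471 654 224)).
Definition tau_dec1 := (Z.opp (decZ 0 207 106 781), decZ 0 978 318 343).

Lemma certified1 : certified (map Z_of_int z_coefs1) (map Z_of_int tau_coefs1)
  z_dec1 tau_dec1 billion (Zpos 20) (Zpos 1000) (Zpos 2) (Zneg 2) Z0.
Proof. by vm_compute. Qed.

Lemma irreducible1 : irreducible_mod (Zpos 3) (map Z_of_int tau_coefs1).
Proof. by vm_compute. Qed.

Definition z_coefs2 : seq int :=
  [:: 1; -2; 4; -2; 1]%Z.
Definition tau_coefs2 : seq int := [:: 1; 0; 1]%Z.
Definition z_dec2 := (decZ 0 742 934 136, Z.opp (decZ 1 529 85 514)).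
Definition tau_dec2 := (Z0, billion).

Lemma certified2 : certified (map Z_of_int z_coefs2) (map Z_of_int tau_coefs2)
  z_dec2 tau_dec2 billion (Zpos 20) (Zpos 1000) (Zpos 2) (Zneg 2) Z0.
Proof. by vm_compute. Qed.

Lemma irreducible2 : irreducible_mod (Zpos 3) (map Z_of_int tau_coefs2).
Proof. by vm_compute. Qed.

Definition z_coefs3 : seq int :=
  [:: 1; -8; 35; -107; 261; -538; 972; -1565; 2282; -3034; 3706; -4171; 4339;
    -4171; 3706; -3034; 2282; -1565; 972; -538; 261; -107; 35; -8; 1]%Z.
Definition tau_coefs3 : seq int :=
  [:: -337; -1847; -3405; -2445; -13; 1054; 823; 489; 257; 91; 23; 6; 1]%Z.
Definition z_dec3 := (decZ 1 404 292 212, Z.opp (decZ 1 179 267 298)).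
Definition tau_dec3 := (decZ 0 632 778 0, Z.opp (decZ 3 19 170 376)).

Lemma certified3 : certified (map Z_of_int z_coefs3) (map Z_of_int tau_coefs3)
  z_dec3 tau_dec3 billion (Zpos 20) (Zpos 1000) (Zneg 4) Z0 (Zpos 2).
Proof. by vm_compute. Qed.

(** Modulo 2 each of the eleven splittings of the degree 12 has only 2^12 pairs of factors to
    test. *)
Lemma irreducible3 : irreducible_mod (Zpos 2) (map Z_of_int tau_coefs3).
Proof. by vm_compute. Qed.

Definition z_coefs4 : seq int :=
  [:: 1; -3; 5; -4; 5; -3; 1]%Z.
Definition tau_coefs4 : seq int := [:: -2; -1; 0; 1]%Z.
Definition z_dec4 := (decZ 1 354 619 901, Z.opp (decZ 1 225 125 454)).
Definition tau_dec4 := (Z.opp (decZ 0 760 689 853), decZ 0 857 873 626).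

Lemma certified4 : certified (map Z_of_int z_coefs4) (map Z_of_int tau_coefs4)
  z_dec4 tau_dec4 billion (Zpos 20) (Zpos 1000) (Zpos 2) (Zneg 2) Z0.
Proof. by vm_compute. Qed.

Lemma irreducible4 : irreducible_mod (Zpos 3) (map Z_of_int tau_coefs4).
Proof. by vm_compute. Qed.

Definition z_coefs5 : seq int :=
  [:: 1; 0; 2; 0; 7; 0; -4; 0; 7; 0; 2; 0; 1]%Z.
Definition tau_coefs5 : seq int := [:: 1; 1; -1; 1]%Z.
Definition z_dec5 := (decZ 0 868 63 287, Z.opp (decZ 1 460 23 666)).
Definition tau_dec5 := (decZ 0 771 844 506, decZ 1 115 142 500).

Lemma certified5 : certified (map Z_of_int z_coefs5) (map Z_of_int tau_coefs5)
  z_dec5 tau_dec5 billion (Zpos 20) (Zpos 1000) (Zpos 2) Z0 (Zneg 1).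
Proof. by vm_compute. Qed.

Lemma irreducible5 : irreducible_mod (Zpos 3) (map Z_of_int tau_coefs5).
Proof. by vm_compute. Qed.

Definition z_coefs6 : seq int :=
  [:: 1; 0; -2; 0; 7; 0; 4; 0; 7; 0; -2; 0; 1]%Z.
Definition tau_coefs6 : seq int := [:: 1; 1; -1; 1]%Z.
Definition z_dec6 := (decZ 1 460 23 666, Z.opp (decZ 0 868 63 287)).
Definition tau_dec6 := (decZ 0 771 844 506, Z.opp (decZ 1 115 142 500)).

Lemma certified6 : certified (map Z_of_int z_coefs6) (map Z_of_int tau_coefs6)
  z_dec6 tau_dec6 billion (Zpos 20) (Zpos 1000) (Zneg 2) Z0 (Zpos 1).
Proof. by vm_compute. Qed.

Lemma irreducible6 : irreducible_mod (Zpos 3) (map Z_of_int tau_coefs6).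
Proof. by vm_compute. Qed.

(* Otherwise unification may unfold [ofZ billion] to a unary numeral. *)
Opaque decZ billion.

Lemma z_poly0 h : z_poly (data R (@Ordinal 7 0 h)) = qpoly z_coefs0.
Proof. by rewrite !qpoly_cons qpoly_nil /data /=; ring. Qed.

Lemma tau_poly0 h : tau_poly (data R (@Ordinal 7 0 h)) = qpoly tau_coefs0.
Proof. by rewrite !qpoly_cons qpoly_nil /data /=; ring. Qed.

Lemma z_approx0 h : z_approx (data R (@Ordinal 7 0 h)) =
  gauss R z_dec0 / ofZ C billion.
Proof. rewrite /z_dec0 gauss_dec_pn; reflexivity. Qed.

Lemma tau_approx0 h : tau_approx (data R (@Ordinal 7 0 h)) =
  gauss R tau_dec0 / ofZ C billion.
Proof. rewrite /tau_dec0 gauss_dec_0p; reflexivity. Qed.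

Lemma tau_root0 h (z : C) : z != 0 ->
  Qeval z (z_poly (data R (@Ordinal 7 0 h))) = 0 ->
  Qeval (1 - (z + z^-1) ^+ 2) (tau_poly (data R (@Ordinal 7 0 h))) = 0.
Proof.
rewrite z_poly0 tau_poly0 !QevalE => z0 zE.
(* The value is the palindromic polynomial of z divided by z^4. In the other cases a constant times
   another power of z serves as multiplier. *)
rewrite -[RHS](mulr0 (1 / z ^+ 4)) -[X in _ = _ * X]zE; by field.
Qed.

Lemma theorem4_at0 h : theorem4_at (@Ordinal 7 0 h).
Proof.
move=> z tau hz htau.
have TE t : (ofZ C (Zpos 2) + ofZ C Z0 * t + ofZ C (Zneg 2) * t ^+ 2) / 2 =
    1 - t ^+ 2.
  by rewrite -[ofZ C (Zpos 2)]/(2 : C) ofZ0 -[ofZ C (Zneg 2)]/(-2 : C); field.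
have [tau_min tau_int z_gt1 tauE] := nearest_roots (z_poly0 h) (tau_poly0 h)
  (z_approx0 h) (tau_approx0 h) certified0
  (erefl : Z.lt 1 (Zpos 5)) erefl isT irreducible0 TE (@tau_root0 h) hz htau.
split=> //.
have st : 2 * tr3 (data R (@Ordinal 7 0 h)) z =
    tr1 (data R (@Ordinal 7 0 h)) z ^+ 2.
  have zE := proj1 (QrootE _ _) (proj1 hz); have [z0 ->] := tr1E zE.
  move: zE; rewrite z_poly0 !QevalE => zE; apply/eqP; rewrite -subr_eq0; apply/eqP.
  (* The difference 2 s - t^2 is the polynomial of z divided by - z^2. *)
  rewrite -[RHS](mulr0 (- z ^- 2)) -[X in _ = _ * X]zE /data /=; by field.
(* The constants come from tau = 1 - t^2 = 1 - 2 s. *)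
apply: (@trace_field_square R _ z tau (proj1 hz) z_gt1 tau_int 1 (-2)) => //.
by rewrite tauE -st; field.
Qed.

Lemma z_poly1 h : z_poly (data R (@Ordinal 7 1 h)) = qpoly z_coefs1.
Proof. by rewrite !qpoly_cons qpoly_nil /data /=; ring. Qed.

Lemma tau_poly1 h : tau_poly (data R (@Ordinal 7 1 h)) = qpoly tau_coefs1.
Proof. by rewrite !qpoly_cons qpoly_nil /data /=; ring. Qed.

Lemma z_approx1 h : z_approx (data R (@Ordinal 7 1 h)) =
  gauss R z_dec1 / ofZ C billion.
Proof. rewrite /z_dec1 gauss_dec_pn; reflexivity. Qed.

Lemma tau_approx1 h : tau_approx (data R (@Ordinal 7 1 h)) =
  gauss R tau_dec1 / ofZ C billion.
Proof. rewrite /tau_dec1 gauss_dec_np; reflexivity. Qed.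

Lemma tau_root1 h (z : C) : z != 0 ->
  Qeval z (z_poly (data R (@Ordinal 7 1 h))) = 0 ->
  Qeval (1 - (z + z^-1)) (tau_poly (data R (@Ordinal 7 1 h))) = 0.
Proof.
rewrite z_poly1 tau_poly1 !QevalE => z0 zE.
rewrite -[RHS](mulr0 (1 / z ^+ 4)) -[X in _ = _ * X]zE; by field.
Qed.

Lemma theorem4_at1 h : theorem4_at (@Ordinal 7 1 h).
Proof.
move=> z tau hz htau.
have TE t : (ofZ C (Zpos 2) + ofZ C (Zneg 2) * t + ofZ C Z0 * t ^+ 2) / 2 =
    1 - t.
  by rewrite -[ofZ C (Zpos 2)]/(2 : C) -[ofZ C (Zneg 2)]/(-2 : C) ofZ0; field.
have [tau_min tau_int z_gt1 tauE] := nearest_roots (z_poly1 h) (tau_poly1 h)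
  (z_approx1 h) (tau_approx1 h) certified1
  (erefl : Z.lt 1 (Zpos 3)) erefl isT irreducible1 TE (@tau_root1 h) hz htau.
split=> //.
by apply: trace_field_linear.
Qed.

Lemma z_poly2 h : z_poly (data R (@Ordinal 7 2 h)) = qpoly z_coefs2.
Proof. by rewrite !qpoly_cons qpoly_nil /data /=; ring. Qed.

Lemma tau_poly2 h : tau_poly (data R (@Ordinal 7 2 h)) = qpoly tau_coefs2.
Proof. by rewrite !qpoly_cons qpoly_nil /data /=; ring. Qed.

Lemma z_approx2 h : z_approx (data R (@Ordinal 7 2 h)) =
  gauss R z_dec2 / ofZ C billion.
Proof. rewrite /z_dec2 gauss_dec_pn; reflexivity. Qed.

Lemma tau_approx2 h : tau_approx (data R (@Ordinal 7 2 h)) =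
  gauss R tau_dec2 / ofZ C billion.
Proof. rewrite /tau_dec2 gauss_dec_i; reflexivity. Qed.

Lemma tau_root2 h (z : C) : z != 0 ->
  Qeval z (z_poly (data R (@Ordinal 7 2 h))) = 0 ->
  Qeval (1 - (z + z^-1)) (tau_poly (data R (@Ordinal 7 2 h))) = 0.
Proof.
rewrite z_poly2 tau_poly2 !QevalE => z0 zE.
rewrite -[RHS](mulr0 (1 / z ^+ 2)) -[X in _ = _ * X]zE; by field.
Qed.

Lemma theorem4_at2 h : theorem4_at (@Ordinal 7 2 h).
Proof.
move=> z tau hz htau.
have TE t : (ofZ C (Zpos 2) + ofZ C (Zneg 2) * t + ofZ C Z0 * t ^+ 2) / 2 =
    1 - t.
  by rewrite -[ofZ C (Zpos 2)]/(2 : C) -[ofZ C (Zneg 2)]/(-2 : C) ofZ0; field.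
have [tau_min tau_int z_gt1 tauE] := nearest_roots (z_poly2 h) (tau_poly2 h)
  (z_approx2 h) (tau_approx2 h) certified2
  (erefl : Z.lt 1 (Zpos 3)) erefl isT irreducible2 TE (@tau_root2 h) hz htau.
split=> //.
by apply: trace_field_linear.
Qed.

(** The palindromic polynomial of z, divided by z^12 and rewritten in t = z + 1 / z. *)
Definition t_coefs3 : seq int :=
  [:: 1; -3; -11; 29; 25; -72; -3; 73; -35; -19; 23; -8; 1]%Z.

(* With [v = tau + 2 = t^2], the minimal polynomial of [t] is
   [E(v) + t O(v)]; these are [E(tau + 2)] and [O(tau + 2)]. *)
Definition even_part3 : seq int := [:: 295; 965; 1247; 797; 255; 35; 1]%Z.
Definition odd_part3 : seq int := [:: -209; -631; -730; -399; -99; -8]%Z.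

Lemma t_root3 (z : C) : z != 0 -> Qeval z (qpoly z_coefs3) = 0 ->
  Qeval (z + z^-1) (qpoly t_coefs3) = 0.
Proof.
rewrite !QevalE => z0 zE.
rewrite -[RHS](mulr0 (1 / z ^+ 12)) -[X in _ = _ * X]zE; by field.
Qed.

Lemma z_poly3 h : z_poly (data R (@Ordinal 7 3 h)) = qpoly z_coefs3.
Proof. by rewrite !qpoly_cons qpoly_nil /data /=; ring. Qed.

Lemma tau_poly3 h : tau_poly (data R (@Ordinal 7 3 h)) = qpoly tau_coefs3.
Proof. by rewrite !qpoly_cons qpoly_nil /data /=; ring. Qed.

Lemma z_approx3 h : z_approx (data R (@Ordinal 7 3 h)) =
  gauss R z_dec3 / ofZ C billion.
Proof. rewrite /z_dec3 gauss_dec_pn; reflexivity. Qed.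

Lemma tau_approx3 h : tau_approx (data R (@Ordinal 7 3 h)) =
  gauss R tau_dec3 / ofZ C billion.
Proof. rewrite /tau_dec3 gauss_dec_pn; reflexivity. Qed.

Lemma tau_root3 h (z : C) : z != 0 ->
  Qeval z (z_poly (data R (@Ordinal 7 3 h))) = 0 ->
  Qeval ((z + z^-1) ^+ 2 - 2) (tau_poly (data R (@Ordinal 7 3 h))) = 0.
Proof.
rewrite z_poly3 tau_poly3 => z0 zE.
(* The polynomial of tau has as roots the t^2 - 2 for the roots t of [t_coefs3]; at t^2 - 2 it
   therefore factors into the values at t and at -t. *)
have -> : Qeval ((z + z^-1) ^+ 2 - 2) (qpoly tau_coefs3) =
    Qeval (z + z^-1) (qpoly t_coefs3) * Qeval (- (z + z^-1)) (qpoly t_coefs3).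
  by move: (z + z^-1) => t; rewrite !QevalE; ring.
by rewrite t_root3 ?mul0r // !QevalE.
Qed.

Lemma theorem4_at3 h : theorem4_at (@Ordinal 7 3 h).
Proof.
move=> z tau hz htau.
have TE t : (ofZ C (Zneg 4) + ofZ C Z0 * t + ofZ C (Zpos 2) * t ^+ 2) / 2 =
    t ^+ 2 - 2.
  by rewrite -[ofZ C (Zneg 4)]/(-4 : C) ofZ0 -[ofZ C (Zpos 2)]/(2 : C); field.
have [tau_min tau_int z_gt1 tauE] := nearest_roots (z_poly3 h) (tau_poly3 h)
  (z_approx3 h) (tau_approx3 h) certified3
  (erefl : Z.lt 1 (Zpos 2)) erefl isT irreducible3 TE (@tau_root3 h) hz htau.
split=> //.
apply: trace_field_quadratic => //; move: tauE; set t := tr1 _ z => tauE.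
have t_eq0 : Qeval t (qpoly t_coefs3) = 0.
  have zE := proj1 (QrootE _ _) (proj1 hz); have [z0 tE] := tr1E zE.
  by rewrite /t tE; apply: t_root3; rewrite // -(z_poly3 h).
(* Separating even and odd powers of t makes the equation of t linear in t over Q(tau). *)
have tE : Qeval tau (qpoly even_part3) + t * Qeval tau (qpoly odd_part3) = 0.
  by rewrite -t_eq0 tauE !QevalE; ring.
(* The odd part has degree 5 in tau, below the degree 12 of the minimal polynomial, so the equation
   can be solved for t. *)
have o_neq0 : Qeval tau (qpoly odd_part3) != 0.
  apply/eqP => /QrootE o_root; have [_ _ tau_le] := tau_min.
  have sz : (size (qpoly odd_part3) <= 6)%N by rewrite size_rat_int_poly size_Poly.
  have := tau_le (qpoly odd_part3); rewrite tau_poly3 qpoly_size //.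
  move=> /(_ _ o_root) le_sz.
  have /le_sz/leq_trans/(_ sz) // : qpoly odd_part3 != 0.
  exact: qpoly_neq0.
have -> : t = - Qeval tau (qpoly even_part3) / Qeval tau (qpoly odd_part3).
  apply: (canRL (mulfK o_neq0)); apply/eqP; rewrite -addr_eq0 addrC.
  exact/eqP.
have subK := @Qadjoin_is_subfield C [set tau].
have Kq l : Qadjoin [set tau] (Qeval tau (qpoly l)).
  by apply: (subfield_Qeval l subK); apply: Qadjoin_mem.
by apply: (subfield_div subK) (Kq odd_part3); apply: (subfieldN subK).
Qed.

Lemma z_poly4 h : z_poly (data R (@Ordinal 7 4 h)) = qpoly z_coefs4.
Proof. by rewrite !qpoly_cons qpoly_nil /data /=; ring. Qed.

Lemma tau_poly4 h : tau_poly (data R (@Ordinal 7 4 h)) = qpoly tau_coefs4.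
Proof. by rewrite !qpoly_cons qpoly_nil /data /=; ring. Qed.

Lemma z_approx4 h : z_approx (data R (@Ordinal 7 4 h)) =
  gauss R z_dec4 / ofZ C billion.
Proof. rewrite /z_dec4 gauss_dec_pn; reflexivity. Qed.

Lemma tau_approx4 h : tau_approx (data R (@Ordinal 7 4 h)) =
  gauss R tau_dec4 / ofZ C billion.
Proof. rewrite /tau_dec4 gauss_dec_np; reflexivity. Qed.

Lemma tau_root4 h (z : C) : z != 0 ->
  Qeval z (z_poly (data R (@Ordinal 7 4 h))) = 0 ->
  Qeval (1 - (z + z^-1)) (tau_poly (data R (@Ordinal 7 4 h))) = 0.
Proof.
rewrite z_poly4 tau_poly4 !QevalE => z0 zE.
rewrite -[RHS](mulr0 (-1 / z ^+ 3)) -[X in _ = _ * X]zE; by field.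
Qed.

Lemma theorem4_at4 h : theorem4_at (@Ordinal 7 4 h).
Proof.
move=> z tau hz htau.
have TE t : (ofZ C (Zpos 2) + ofZ C (Zneg 2) * t + ofZ C Z0 * t ^+ 2) / 2 =
    1 - t.
  by rewrite -[ofZ C (Zpos 2)]/(2 : C) -[ofZ C (Zneg 2)]/(-2 : C) ofZ0; field.
have [tau_min tau_int z_gt1 tauE] := nearest_roots (z_poly4 h) (tau_poly4 h)
  (z_approx4 h) (tau_approx4 h) certified4
  (erefl : Z.lt 1 (Zpos 3)) erefl isT irreducible4 TE (@tau_root4 h) hz htau.
split=> //.
by apply: trace_field_linear.
Qed.

Lemma z_poly5 h : z_poly (data R (@Ordinal 7 5 h)) = qpoly z_coefs5.
Proof. by rewrite !qpoly_cons qpoly_nil /data /=; ring. Qed.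

Lemma tau_poly5 h : tau_poly (data R (@Ordinal 7 5 h)) = qpoly tau_coefs5.
Proof. by rewrite !qpoly_cons qpoly_nil /data /=; ring. Qed.

Lemma z_approx5 h : z_approx (data R (@Ordinal 7 5 h)) =
  gauss R z_dec5 / ofZ C billion.
Proof. rewrite /z_dec5 gauss_dec_pn; reflexivity. Qed.

Lemma tau_approx5 h : tau_approx (data R (@Ordinal 7 5 h)) =
  gauss R tau_dec5 / ofZ C billion.
Proof. rewrite /tau_dec5 gauss_dec_pp; reflexivity. Qed.

Lemma tau_root5 h (z : C) : z != 0 ->
  Qeval z (z_poly (data R (@Ordinal 7 5 h))) = 0 ->
  Qeval (1 - (z + z^-1) ^+ 2 / 2) (tau_poly (data R (@Ordinal 7 5 h))) = 0.
Proof.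
rewrite z_poly5 tau_poly5 !QevalE => z0 zE.
rewrite -[RHS](mulr0 (- (1 / 8) / z ^+ 6)) -[X in _ = _ * X]zE; by field.
Qed.

Lemma theorem4_at5 h : theorem4_at (@Ordinal 7 5 h).
Proof.
move=> z tau hz htau.
have TE t : (ofZ C (Zpos 2) + ofZ C Z0 * t + ofZ C (Zneg 1) * t ^+ 2) / 2 =
    1 - t ^+ 2 / 2.
  by rewrite -[ofZ C (Zpos 2)]/(2 : C) ofZ0 -[ofZ C (Zneg 1)]/(-1 : C); field.
have [tau_min tau_int z_gt1 tauE] := nearest_roots (z_poly5 h) (tau_poly5 h)
  (z_approx5 h) (tau_approx5 h) certified5
  (erefl : Z.lt 1 (Zpos 3)) erefl isT irreducible5 TE (@tau_root5 h) hz htau.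
split=> //.
have st : 2 * tr3 (data R (@Ordinal 7 5 h)) z =
    tr1 (data R (@Ordinal 7 5 h)) z ^+ 2.
  have zE := proj1 (QrootE _ _) (proj1 hz); have [z0 ->] := tr1E zE.
  move: zE; rewrite z_poly5 !QevalE => zE; apply/eqP; rewrite -subr_eq0; apply/eqP.
  rewrite -[RHS](mulr0 (- z ^- 2)) -[X in _ = _ * X]zE /data /=; by field.
apply: (@trace_field_square R _ z tau (proj1 hz) z_gt1 tau_int 1 (-1)) => //.
by rewrite tauE -st; field.
Qed.

Lemma z_poly6 h : z_poly (data R (@Ordinal 7 6 h)) = qpoly z_coefs6.
Proof. by rewrite !qpoly_cons qpoly_nil /data /=; ring. Qed.

Lemma tau_poly6 h : tau_poly (data R (@Ordinal 7 6 h)) = qpoly tau_coefs6.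
Proof. by rewrite !qpoly_cons qpoly_nil /data /=; ring. Qed.

Lemma z_approx6 h : z_approx (data R (@Ordinal 7 6 h)) =
  gauss R z_dec6 / ofZ C billion.
Proof. rewrite /z_dec6 gauss_dec_pn; reflexivity. Qed.

Lemma tau_approx6 h : tau_approx (data R (@Ordinal 7 6 h)) =
  gauss R tau_dec6 / ofZ C billion.
Proof. rewrite /tau_dec6 gauss_dec_pn; reflexivity. Qed.

Lemma tau_root6 h (z : C) : z != 0 ->
  Qeval z (z_poly (data R (@Ordinal 7 6 h))) = 0 ->
  Qeval ((z + z^-1) ^+ 2 / 2 - 1) (tau_poly (data R (@Ordinal 7 6 h))) = 0.
Proof.
rewrite z_poly6 tau_poly6 !QevalE => z0 zE.
rewrite -[RHS](mulr0 (1 / 8 / z ^+ 6)) -[X in _ = _ * X]zE; by field.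
Qed.

Lemma theorem4_at6 h : theorem4_at (@Ordinal 7 6 h).
Proof.
move=> z tau hz htau.
have TE t : (ofZ C (Zneg 2) + ofZ C Z0 * t + ofZ C (Zpos 1) * t ^+ 2) / 2 =
    t ^+ 2 / 2 - 1.
  by rewrite -[ofZ C (Zneg 2)]/(-2 : C) ofZ0 -[ofZ C (Zpos 1)]/(1 : C); field.
have [tau_min tau_int z_gt1 tauE] := nearest_roots (z_poly6 h) (tau_poly6 h)
  (z_approx6 h) (tau_approx6 h) certified6
  (erefl : Z.lt 1 (Zpos 3)) erefl isT irreducible6 TE (@tau_root6 h) hz htau.
split=> //.
have st : 2 * tr3 (data R (@Ordinal 7 6 h)) z =
    tr1 (data R (@Ordinal 7 6 h)) z ^+ 2.
  have zE := proj1 (QrootE _ _) (proj1 hz); have [z0 ->] := tr1E zE.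
  move: zE; rewrite z_poly6 !QevalE => zE; apply/eqP; rewrite -subr_eq0; apply/eqP.
  rewrite -[RHS](mulr0 (- z ^- 2)) -[X in _ = _ * X]zE /data /=; by field.
apply: (@trace_field_square R _ z tau (proj1 hz) z_gt1 tau_int (-1) 1) => //.
by rewrite tauE -st; field.
Qed.

End Cases.

Theorem theorem4 (R : realType) (i : 'I_7) (z tau : R[i])
    (hz : is_nearest_root (z_poly (data R i)) (z_approx (data R i)) z)
    (htau : is_nearest_root (tau_poly (data R i)) (tau_approx (data R i)) tau) :
  is_minimal_polynomial (tau_poly (data R i)) tau /\
  invariant_trace_field (Ggroup (proj1 hz)) = Qadjoin [set tau].
Proof.
case: i hz htau => -[|[|[|[|[|[|[|//]]]]]]] h hz htau;
  [exact: theorem4_at0 | exact: theorem4_at1 | exact: theorem4_at2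
  | exact: theorem4_at3 | exact: theorem4_at4 | exact: theorem4_at5
  | exact: theorem4_at6].
Qed.
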